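(* Let $\mathcal{M}$ be the set of weak equivalence classes of Markov graphops. Then $(\mathcal{M},d_M)$ is a compact metric space.
   Context: For a probability space $(\Omega,\mathcal{A},\mu)$, a $P$-operator on $\Omega$ is a linear map $A:L^\infty(\Omega)\to L^1(\Omega)$, $v\mapsto vA$, with $\|A\|_{\infty\to1}:=\sup_{v}\|vA\|_1/\|v\|_\infty<\infty$. Write $(f,g)_A:=\int_\Omega (fA)g\,d\mu$. $A$ is self-adjoint if $(v,w)_A=(w,v)_A$ for all $v,w\in L^\infty(\Omega)$; positivity-preserving if $v\ge0$ a.e. implies $vA\ge0$ a.e.; $1$-regular if $1_\Omega A=1_\Omega$. A Markov graphop is a self-adjoint, positivity-preserving, $1$-regular $P$-operator. The $k$-profile $\mathcal{S}_k(A)$ is the set of joint distributions (on $\mathbb{R}^{2k}$) of $(v_1,\dots,v_k,v_1A,\dots,v_kA)$ for measurable $v_i:\Omega\to[-1,1]$. With $d_{\rm LP}$ the Lévy–Prokhorov metric and $d_H$ the induced Hausdorff distance between sets of probability measures, $d_M(A,B):=\sum_{k\ge1}2^{-k}d_H(\mathcal{S}_k(A),\mathcal{S}_k(B))$ for $P$-operators on possibly different spaces. $A,B$ are weakly equivalent if $d_M(A,B)=0$. *)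

(* Defs.v *)
From HB Require Import structures.
From mathcomp Require Import all_boot all_order all_algebra.
From mathcomp Require Import all_classical all_reals all_analysis.
Set Implicit Arguments. Unset Strict Implicit. Unset Printing Implicit Defensive.
Import Order.TTheory GRing.Theory Num.Theory.
Import numFieldNormedType.Exports.
Local Open Scope classical_set_scope.
Local Open Scope ring_scope.

Section defs.
Variable R : realType.

(** L^oo(Omega): represented by measurable, (everywhere) bounded real functions;
    every class of L^oo has such a representative. *)
Definition Linf d (T : measurableType d) (v : T -> R) : Prop :=
  measurable_fun setT v /\ exists M : R, forall x, `|v x| <= M.

Definition P_operator d (T : measurableType d) (P : probability T R)
  (A : (T -> R) -> (T -> R)) : Prop :=
  [/\
      forall v w, Linf v -> Linf w -> {ae P, forall x, v x = w x} ->
        {ae P, forall x, A v x = A w x},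
      forall v, Linf v -> measurable_fun setT (A v) /\
        P.-integrable setT (EFin \o A v),
      forall (a b : R) v w, Linf v -> Linf w ->
        {ae P, forall x, A (fun y => a * v y + b * w y) x = a * A v x + b * A w x}
    &
      exists C : R, forall v (M : R), Linf v -> {ae P, forall x, `|v x| <= M} ->
        (\int[P]_x (`|A v x|)%:E <= (C * M)%:E)%E ].

Definition pairing d (T : measurableType d) (P : probability T R)
  (A : (T -> R) -> (T -> R)) (f g : T -> R) : \bar R :=
  (\int[P]_x (A f x * g x)%:E)%E.

Definition self_adjoint d (T : measurableType d) (P : probability T R)
  (A : (T -> R) -> (T -> R)) : Prop :=
  forall v w, Linf v -> Linf w -> pairing P A v w = pairing P A w v.

Definition positivity_preserving d (T : measurableType d) (P : probability T R)
  (A : (T -> R) -> (T -> R)) : Prop :=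
  forall v, Linf v -> {ae P, forall x, 0 <= v x} -> {ae P, forall x, 0 <= A v x}.

Definition one_regular d (T : measurableType d) (P : probability T R)
  (A : (T -> R) -> (T -> R)) : Prop :=
  {ae P, forall x, A (fun _ => 1) x = 1}.

Definition markov_graphop d (T : measurableType d) (P : probability T R)
  (A : (T -> R) -> (T -> R)) : Prop :=
  [/\ P_operator P A, self_adjoint P A, positivity_preserving P A & one_regular P A].

Record MarkovGraphop := MkMarkovGraphop {
  mg_disp : measure_display;
  mg_T : measurableType mg_disp;
  mg_P : probability mg_T R;
  mg_A : (mg_T -> R) -> (mg_T -> R);
  mg_markov : markov_graphop mg_P mg_A }.

Definition edist n (x y : 'I_n -> R) : R :=
  Num.sqrt (\sum_(i < n) (x i - y i) ^+ 2).

Definition eopen n (U : set ('I_n -> R)) : Prop :=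
  forall x, U x -> exists2 e : R, 0 < e & forall y, edist x y < e -> U y.

Definition borel n : set (set ('I_n -> R)) :=
  smallest (sigma_algebra setT) (@eopen n).

Definition eps_nbhd n (e : R) (B : set ('I_n -> R)) : set ('I_n -> R) :=
  [set x | exists2 y, B y & edist x y < e].

Definition dLP n d1 (T1 : measurableType d1) (P1 : probability T1 R)
  (X : T1 -> ('I_n -> R)) d2 (T2 : measurableType d2) (P2 : probability T2 R)
  (Y : T2 -> ('I_n -> R)) : R :=
  inf [set e : R | 0 < e /\ forall B, borel B ->
     (P1 (X @^-1` B) <= P2 (Y @^-1` eps_nbhd e B) + e%:E)%E /\
     (P2 (Y @^-1` B) <= P1 (X @^-1` eps_nbhd e B) + e%:E)%E].

Definition test_family k d (T : measurableType d) (v : 'I_k -> T -> R) : Prop :=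
  forall i, measurable_fun setT (v i) /\ forall x, -1 <= v i x <= 1.

Definition profile_vec k d (T : measurableType d) (A : (T -> R) -> (T -> R))
  (v : 'I_k -> T -> R) : T -> ('I_(k + k) -> R) :=
  fun x j => match fintype.split j with inl i => v i x | inr i => A (v i) x end.

Definition dH_half k (G H : MarkovGraphop) : R :=
  sup [set inf [set dLP (mg_P G) (profile_vec (@mg_A G) v)
                        (mg_P H) (profile_vec (@mg_A H) w)
               | w in @test_family k _ (mg_T H)]
      | v in @test_family k _ (mg_T G)].

Definition dH k (G H : MarkovGraphop) : R := Num.max (dH_half k G H) (dH_half k H G).

Definition dM (G H : MarkovGraphop) : R :=
  limn (series (fun k : nat => (2%:R ^- k.+1) * dH k.+1 G H)).

Definition weakly_equivalent (G H : MarkovGraphop) : Prop := dM G H = 0.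

(** open sets (as predicates, for universe reasons) of the (pseudo)metric d_M; these are saturated w.r.t. weak
    equivalence, so they are exactly the preimages of the open sets of the
    metric quotient (M, d_M). *)
Definition dM_open (U : MarkovGraphop -> Prop) : Prop :=
  forall G, U G -> exists2 e : R, 0 < e & forall H, dM G H < e -> U H.

Definition dM_compact : Prop :=
  forall (I : Type) (U : I -> MarkovGraphop -> Prop),
    (forall i, dM_open (U i)) -> (forall G, exists i, U i G) ->
    exists (n : nat) (f : 'I_n -> I), forall G, exists j : 'I_n, U (f j) G.

End defs.

(* Main.v *)
Require Import Defs.
From HB Require Import structures.
From mathcomp Require Import all_boot all_order all_algebra.
From mathcomp Require Import all_classical all_reals all_analysis measurable_realfun.
From mathcomp Require Import ring lra.
Set Implicit Arguments. Unset Strict Implicit. Unset Printing Implicit Defensive.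
Import Order.TTheory GRing.Theory Num.Theory.
Import numFieldNormedType.Exports. Import Defs.
Local Open Scope classical_set_scope.
Local Open Scope ring_scope.

(** The limit of a sequence [G n] of Markov graphops is its Loeb ultraproduct:
    the product of the underlying spaces, on which a set is measurable when it
    agrees, up to a null set, with an internal set [{x | C n (x n) for almost
    all n}] along a fixed nonprincipal ultrafilter, and the measure of the latter
    is the ultralimit of the measures of the [C n].  A bounded measurable function
    on the ultraproduct is almost everywhere the standard part [st f], that is, the
    pointwise ultralimit, of a uniformly bounded sequence [f n], and its integral
    is the ultralimit of the integrals.  A Markov graphop contracts both the sup norm
    and the [L^1] norm, so [st f |-> st (A n (f n))] is well defined almost
    everywhere, and it is again a Markov graphop.  As joint laws of standard parts
    are Levy-Prokhorov ultralimits of joint laws, the profiles of [G n] tend to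
    those of the ultraproduct along the ultrafilter.  Hence every sequence has a
    convergent subsequence, and compactness follows by a Lebesgue number and total
    boundedness. *)

(** A Markov graphop may live on any probability space, so the Loeb space, which need not be
    standard Borel, is admissible as a limit. The first obstacle is that the limit operator be well
    defined: two lifts of one function have standard parts that agree only almost everywhere, with
    no uniform closeness in the coordinates, so the sup-norm contraction says nothing about their
    images. The $L^1$ contraction does. It comes from $\int|vA| \le \int(|v|A)\cdot 1 =
    \int|v|\cdot(1A) = \int|v|$, that is, from positivity, self-adjointness and 1-regularity
    together. The second obstacle is uniformity over test families. Families on the [G n] assemble
    into one internal family, whose standard part handles them all. Families on the ultraproduct
    that vary with [n] do not assemble; there, a finite partition into digit cells reduces laws, up
    to a small error, to vectors in a compact cube, and one family can be frozen. The digits reduce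
    functions to sets, whose measures converge by construction. *)

(** * A nonprincipal ultrafilter on the natural numbers *)

Lemma ultrafilter_above_oo : exists U : set_system nat, UltraFilter U /\ \oo `<=` U.
Proof. exact: ultraFilterLemma. Qed.

Definition ultra : set_system nat := projT1 (cid ultrafilter_above_oo).

#[local] Instance ultra_ultrafilter : UltraFilter ultra.
Proof. by case: (projT2 (cid ultrafilter_above_oo)). Qed.

Lemma ultra_oo : \oo `<=` ultra.
Proof. by case: (projT2 (cid ultrafilter_above_oo)). Qed.

Lemma ultra_ge (N : nat) : ultra [set n | (N <= n)%N].
Proof. by apply: ultra_oo; exists N. Qed.

Lemma ultraNP (A : set nat) : ~ ultra A <-> ultra (~` A).
Proof.
split=> [nA|nA UA]; first by case: (in_ultra_setVsetC A ultra_ultrafilter).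
by have [n []] := filter_ex (filterI UA nA).
Qed.

Lemma ultraUP (A B : set nat) : ultra (A `|` B) <-> ultra A \/ ultra B.
Proof.
split=> [UAB|[]]; last 2 first.
- by apply: filterS; left.
- by apply: filterS; right.
have [|/ultraNP nA] := pselect (ultra A); [by left|right].
by apply: filterS (filterI UAB nA) => n [[]].
Qed.

(** * Ultralimits of bounded real sequences *)

Section ulim.
Context {R : realType}.
Implicit Types u v : nat -> R.

Definition ulim u : R := lim (u @ ultra).

Lemma fmap_ultra u : UltraFilter (u @ ultra).
Proof.
split=> [|G PG sUG]; first exact: fmap_proper_filter.
apply/seteqP; split=> [A GA|]; last exact: sUG.
apply: contrapT => /ultraNP nA.
have GnA : G (~` A) by apply: sUG; exact: nA.
by have [x []] := filter_ex (filterI GA GnA).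
Qed.

(** The image of [ultra] under [u] is an ultrafilter containing the compact interval $[-M, M]$,
    where every ultrafilter converges. *)
Lemma cvg_ulim u M : (forall n, `|u n| <= M) -> u @ ultra --> ulim u.
Proof.
move=> uM; suff [l ul] : exists l : R, u @ ultra --> l by exact: (cvgP l ul).
have := @segment_compact R (- M) M; rewrite compact_ultra => /(_ (u @ ultra)).
case=> [||l [_ ?]]; first exact: fmap_ultra; last by exists l.
by apply: nearW => n /=; rewrite in_itv/= -ler_norml.
Qed.

Lemma ulimE u l : u @ ultra --> l -> ulim u = l.
Proof. exact: cvg_lim. Qed.

Lemma ulim_cst l : ulim (fun=> l) = l.
Proof. by apply: ulimE; exact: cvg_cst. Qed.

Lemma near_ulimB u l e : 0 < e -> u @ ultra --> l ->
  ultra [set n | `|u n - l| <= e].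
Proof.
move=> e0 ul; have /cvgrPdist_le /(_ _ e0) := ul.
by apply: filterS => n /=; rewrite distrC.
Qed.

Lemma ulim_le_near u l x : u @ ultra --> l ->
  ultra [set n | u n <= x] -> l <= x.
Proof. by move=> ul ux; apply: ler_cvg_to ul (cvg_cst x) ux. Qed.

Lemma cvg_bigsum (I : Type) (s : seq I) (u : I -> nat -> R) (l : I -> R) :
  (forall i, u i @ ultra --> l i) ->
  (fun n => \sum_(i <- s) u i n) @ ultra --> \sum_(i <- s) l i.
Proof.
move=> ul; elim: s => [|i s IH].
  rewrite big_nil (_ : (fun _ => _) = fun=> 0); first exact: cvg_cst.
  by apply/funext => n; rewrite big_nil.
rewrite big_cons (_ : (fun _ => _) = fun n => u i n + \sum_(j <- s) u j n).
  exact: cvgD.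
by apply/funext => n; rewrite big_cons.
Qed.

End ulim.

Lemma sum_half_expn {R : realType} N : \sum_(j < N) 2^-1 ^+ j.+1 = 1 - 2^-1 ^+ N :> R.
Proof.
elim: N => [|N IH]; first by rewrite big_ord0 expr0 subrr.
by rewrite big_ord_recr /= IH exprS; set a := _ ^+ N; lra.
Qed.

(** * Probabilities as real numbers *)

Section prob.
Context {R : realType} d (T : measurableType d) (Q : probability T R).
Implicit Types A B : set T.

Definition pr A : R := fine (Q A).

Lemma pr_fin A : measurable A -> Q A = (pr A)%:E.
Proof. by move=> mA; rewrite /pr fineK// fin_num_measure. Qed.

Lemma pr_ge0 A : 0 <= pr A.
Proof. exact: fine_ge0. Qed.

Lemma pr_le1 A : measurable A -> pr A <= 1.
Proof. by move=> mA; rewrite -lee_fin -pr_fin// probability_le1. Qed.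

Lemma pr_norm A : measurable A -> `|pr A| <= 1.
Proof. by move=> mA; rewrite ger0_norm ?pr_ge0// pr_le1. Qed.

Lemma pr_mono A B : measurable A -> measurable B -> A `<=` B -> pr A <= pr B.
Proof.
by move=> mA mB AB; rewrite -lee_fin -!pr_fin// le_measure ?inE.
Qed.

Lemma prU_le A B : measurable A -> measurable B -> pr (A `|` B) <= pr A + pr B.
Proof.
move=> mA mB; rewrite -lee_fin EFinD -!pr_fin//; last exact: measurableU.
exact: measureU2.
Qed.

Lemma prU A B : measurable A -> measurable B -> A `&` B = set0 ->
  pr (A `|` B) = pr A + pr B.
Proof.
move=> mA mB AB; apply: EFin_inj; rewrite EFinD -!pr_fin//.
  exact: measureU.
exact: measurableU.
Qed.

Lemma prDI A B : measurable A -> measurable B -> pr A = pr (A `&` B) + pr (A `\` B).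
Proof.
move=> mA mB; rewrite -prU ?setUIDK ?setID//.
- exact: measurableI.
- exact: measurableD.
- by rewrite setDE setIACA setICr setI0.
Qed.

End prob.

(** * The Loeb space: internal sets, saturation, sigma-algebra and measure *)

Section loeb.
Context {R : realType} (d : nat -> measure_display)
  (T : forall n, measurableType (d n)) (P : forall n, probability (T n) R).

(** The measures are kept in the type because the sigma-algebra, which admits errors on null sets,
    depends on them and instance resolution has to recover them. *)
Definition loeb of (forall n, probability (T n) R) : Type := forall n, T n.

Implicit Types (C D : forall n, set (T n)) (E : set (loeb P)).

Definition internal C := forall n, measurable (C n).

(** No quotient by agreement along [ultra] is taken: hulls are saturated for this relation, and a
    probability space need not separate points. *)
Definition hull C : set (loeb P) := [set x | ultra [set n | C n (x n)]].

Definition wP C : R := ulim (fun n => pr (P n) (C n)).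

Definition isetU C D n := C n `|` D n.
Definition isetI C D n := C n `&` D n.
Definition isetD C D n := C n `\` D n.
Definition isetC C n := ~` C n.

Arguments isetU C D n _ : clear implicits.
Arguments isetI C D n _ : clear implicits.
Arguments isetD C D n _ : clear implicits.
Arguments isetC C n _ : clear implicits.

Lemma internalU C D : internal C -> internal D -> internal (isetU C D).
Proof. by move=> iC iD n; exact: measurableU. Qed.

Lemma internalI C D : internal C -> internal D -> internal (isetI C D).
Proof. by move=> iC iD n; exact: measurableI. Qed.

Lemma internalD C D : internal C -> internal D -> internal (isetD C D).
Proof. by move=> iC iD n; exact: measurableD. Qed.

Lemma internalC C : internal C -> internal (isetC C).
Proof. by move=> iC n; exact: measurableC. Qed.

Lemma hullU C D x : hull (isetU C D) x <-> hull C x \/ hull D x.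
Proof. exact: ultraUP. Qed.

Lemma hullC C x : hull (isetC C) x <-> ~ hull C x.
Proof. by rewrite [X in _ <-> X]ultraNP. Qed.

Lemma hullI C D x : hull (isetI C D) x <-> hull C x /\ hull D x.
Proof.
split=> [h|[hC hD]]; last exact: filterI.
by split; apply: filterS h => n [].
Qed.

Lemma hullD C D x : hull (isetD C D) x <-> hull C x /\ ~ hull D x.
Proof. by rewrite -hullC -hullI. Qed.

(** Otherwise a counterexample chosen in each coordinate would give a point of [hull C] outside
    [hull D]. This is how inclusions of hulls return to the coordinates. *)
Lemma hull_sub C D : hull C `<=` hull D -> ultra [set n | C n `<=` D n].
Proof.
move=> CD; apply: contrapT => /ultraNP U.
have xP n : {y : T n | ~ (C n `<=` D n) -> C n y /\ ~ D n y}.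
  apply: cid; have [?|/existsNP[y /not_implyP CDy]] := pselect (C n `<=` D n).
    by exists point.
  by exists y.
pose x : loeb P := fun n => projT1 (xP n).
have hx : ultra [set n | C n (x n) /\ ~ D n (x n)].
  by apply: filterS U => n; rewrite /x; exact: (projT2 (xP n)).
have hC : hull C x by apply: filterS hx => n [].
have := CD _ hC; apply/ultraNP; apply: filterS hx => n [].
by [].
Qed.

Lemma cvg_wP C : internal C -> (fun n => pr (P n) (C n)) @ ultra --> wP C.
Proof. by move=> iC; apply: (@cvg_ulim _ _ 1) => n; exact: pr_norm. Qed.

Lemma wP_ge0 C : internal C -> 0 <= wP C.
Proof.
move=> iC; apply: ler_cvg_to (cvg_cst 0) (cvg_wP iC) _.
by apply: nearW => n; exact: pr_ge0.
Qed.

Lemma wP_near C D : internal C -> internal D ->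
  ultra [set n | C n `<=` D n] -> wP C <= wP D.
Proof.
move=> iC iD CD; apply: ler_cvg_to (cvg_wP iC) (cvg_wP iD) _.
by apply: filterS CD => n /= ?; exact: pr_mono.
Qed.

Lemma wP_mono C D : internal C -> internal D -> hull C `<=` hull D -> wP C <= wP D.
Proof. by move=> iC iD /hull_sub; exact: wP_near. Qed.

Lemma wPDI C D : internal C -> internal D -> wP C = wP (isetI C D) + wP (isetD C D).
Proof.
move=> iC iD; apply: ulimE.
rewrite (_ : (fun _ => _) =
  (fun n => pr (P n) (isetI C D n) + pr (P n) (isetD C D n))).
  by apply: cvgD; apply: cvg_wP; [exact: internalI|exact: internalD].
by apply/funext => n; exact: prDI.
Qed.

Lemma wPU_le C D : internal C -> internal D -> wP (isetU C D) <= wP C + wP D.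
Proof.
move=> iC iD.
apply: ler_cvg_to (cvg_wP (internalU iC iD)) (cvgD (cvg_wP iC) (cvg_wP iD)) _.
by apply: nearW => n; exact: prU_le.
Qed.

Lemma wP0 C : (forall n, C n = set0) -> wP C = 0.
Proof.
move=> C0; rewrite /wP (_ : (fun _ => _) = fun=> 0) ?ulim_cst//.
by apply/funext => n; rewrite C0 /pr measure0.
Qed.

Lemma wPT C : (forall n, C n = setT) -> wP C = 1.
Proof.
move=> C0; rewrite /wP (_ : (fun _ => _) = fun=> 1) ?ulim_cst//.
by apply/funext => n; rewrite C0 /pr probability_setT.
Qed.

(* Countable saturation: an increasing sequence of internal sets is contained in
   an internal set of the limiting measure.  The [n]-th component of the latter
   collects the [n]-th components of those members of the sequence, up to index
   [n], whose measure is close enough to the limit. *)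
Lemma saturation (F : nat -> forall n, set (T n)) (c : R) :
  (forall i, internal (F i)) -> (forall i j n, (i <= j)%N -> F i n `<=` F j n) ->
  (forall i, wP (F i) <= c) ->
  exists D, [/\ internal D, forall i, ultra [set n | F i n `<=` D n] & wP D <= c].
Proof.
move=> iF mF Fc.
pose good n j := (j <= n)%N /\ pr (P n) (F j n) <= c + j.+1%:R^-1.
pose D n := \bigcup_(j in [set j | good n j]) F j n.
have iD : internal D by move=> n; apply: bigcup_measurable => j _; exact: iF.
have gU i : ultra [set n | good n i].
  apply: filterI; first exact: ultra_ge.
  have i0 : 0 < i.+1%:R^-1 :> R by rewrite invr_gt0.
  have := near_ulimB i0 (cvg_wP (iF i)).
  apply: filterS => n /=; rewrite ler_norml => /andP[_ h]; have Fci := Fc i.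
  rewrite lerBlDr in h; apply: (le_trans h).
  by rewrite addrC lerD2r.
exists D; split=> [//|i|].
  by apply: filterS (gU i) => n gn y Fy; exists i.
have Di i : wP D <= c + i.+1%:R^-1.
  apply: ulim_le_near (cvg_wP iD) _; apply: filterS (gU i) => n gi /=.
  (* [D n] is the set [F m n] for the largest good [m], since good indices are at most [n] and the
     sets increase. As [i] is good, [i <= m], so the slack of [m] is at most that of [i]. *)
  have ex : exists j, `[< good n j >] by exists i; exact/asboolP.
  have bd j : `[< good n j >] -> (j <= n)%N by move=> /asboolP[].
  have [m /asboolP gm mmax] := ex_maxnP ex bd.
  have DF : D n = F m n.
    apply/seteqP; split=> [y [j gj Fy]|y Fy]; last by exists m.
    by apply: mF Fy; apply: mmax; exact/asboolP.
  rewrite DF; apply: (le_trans gm.2); rewrite lerD2l lef_pV2 ?posrE// ler_nat ltnS.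
  by apply: mmax; exact/asboolP.
apply/ler_addgt0Pr => e e0.
have [k] := ltr_add_invr e0; rewrite add0r => ke; apply: (le_trans (Di k)).
by rewrite lerD2l ltW.
Qed.

(** The symmetric difference of [E] and [hull C] is null in the outer sense: internal sets of
    arbitrarily small weight cover it. This makes sense before any measure on the product exists. *)
Definition lapprox E C := internal C /\ forall e, 0 < e -> exists D,
  [/\ internal D, wP D <= e & forall x, ~ hull D x -> (E x <-> hull C x)].

Lemma approx_hull C : internal C -> lapprox (hull C) C.
Proof.
move=> iC; split=> // e e0; exists (fun=> set0); split=> [n| |//].
  exact: measurable0.
by rewrite wP0// ltW.
Qed.

Lemma approx_ext E E' C : (forall x, E x <-> E' x) -> lapprox E C -> lapprox E' C.
Proof.
move=> EE' [iC aC]; split=> // e /aC[D [iD De H]]; exists D; split=> // x.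
by rewrite -EE'; exact: H.
Qed.

(** Off two internal sets of small weight, [hull C] lies in [hull C']. With [E = E'] this makes the
    weight of [E] independent of its internal representative. *)
Lemma approx_wP_le E E' C C' : E `<=` E' -> lapprox E C -> lapprox E' C' ->
  wP C <= wP C'.
Proof.
move=> EE' [iC aC] [iC' aC']; apply/ler_addgt0Pr => e e0.
have e20 : 0 < e / 2 by rewrite divr_gt0.
have [D [iD De HD]] := aC _ e20; have [D' [iD' De' HD']] := aC' _ e20.
have iU := internalU iD iD'.
have : wP C <= wP (isetU C' (isetU D D')).
  apply: wP_mono => //; first exact: internalU.
  move=> x Cx; apply/hullU.
  have [|/hullU/not_orP[nD nD']] := pselect (hull (isetU D D') x); first by right.
  by left; apply/(HD' _ nD')/EE'/(HD _ nD).
have := wPU_le iC' iU; have := wPU_le iD iD'; lra.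
Qed.

Lemma approx_wP E C C' : lapprox E C -> lapprox E C' -> wP C = wP C'.
Proof.
by move=> aC aC'; apply/eqP; rewrite eq_le !(@approx_wP_le E E).
Qed.

Lemma approxC E C : lapprox E C -> lapprox (~` E) (isetC C).
Proof.
move=> [iC aC]; split=> [|e /aC[D [iD De HD]]]; first exact: internalC.
by exists D; split=> // x /HD EC; rewrite hullC -EC.
Qed.

Lemma approx2 E E' C C' : lapprox E C -> lapprox E' C' -> forall e, 0 < e ->
  exists D, [/\ internal D, wP D <= e &
    forall x, ~ hull D x -> (E x <-> hull C x) /\ (E' x <-> hull C' x)].
Proof.
move=> [iC aC] [iC' aC'] e e0.
have e20 : 0 < e / 2 by rewrite divr_gt0.
have [D [iD De HD]] := aC _ e20; have [D' [iD' De' HD']] := aC' _ e20.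
exists (isetU D D'); split; first exact: internalU.
  by have := wPU_le iD iD'; lra.
by move=> x /hullU/not_orP[/HD h /HD' h'].
Qed.

Lemma approxU E E' C C' : lapprox E C -> lapprox E' C' ->
  lapprox (E `|` E') (isetU C C').
Proof.
move=> aC aC'; split=> [|e /(approx2 aC aC')[D [iD De h]]].
  by apply: internalU; [case: aC|case: aC'].
by exists D; split=> // x /h[h1 h2]; rewrite hullU -h1 -h2.
Qed.

Lemma approxI E E' C C' : lapprox E C -> lapprox E' C' ->
  lapprox (E `&` E') (isetI C C').
Proof.
move=> aC aC'; split=> [|e /(approx2 aC aC')[D [iD De h]]].
  by apply: internalI; [case: aC|case: aC'].
by exists D; split=> // x /h[h1 h2]; rewrite hullI -h1 -h2.
Qed.

Fixpoint isetUn (C : nat -> forall n, set (T n)) (i : nat) : forall n, set (T n) :=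
  if i is i'.+1 then isetU (isetUn C i') (C i) else C 0%N.

Arguments isetUn C i n _ : clear implicits.

Lemma internalUn (C : nat -> forall n, set (T n)) i :
  (forall i, internal (C i)) -> internal (isetUn C i).
Proof. by move=> iC; elim: i => //= i IH; exact: internalU. Qed.

Lemma isetUn_mono (C : nat -> forall n, set (T n)) i j n :
  (i <= j)%N -> isetUn C i n `<=` isetUn C j n.
Proof.
move=> /subnKC <-; elim: (j - i)%N => [|k IH]; first by rewrite addn0.
by rewrite addnS /= => y /IH; left.
Qed.

Lemma hullUn (C : nat -> forall n, set (T n)) i x :
  hull (isetUn C i) x <-> exists2 j, (j <= i)%N & hull (C j) x.
Proof.
elim: i => [|i IH] /=.
  by split=> [h|[j]]; [exists 0%N|rewrite leqn0 => /eqP ->].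
rewrite hullU IH; split=> [[[j ji h]|h]|[j]].
- by exists j => //; exact: leqW.
- by exists i.+1.
- rewrite leq_eqVlt => /orP[/eqP -> h|ji h]; first by right.
  by left; exists j.
Qed.

Lemma wPUn_le (C : nat -> forall n, set (T n)) (a : nat -> R) i : (forall i, internal (C i)) ->
  (forall i, wP (C i) <= a i) -> wP (isetUn C i) <= \sum_(j < i.+1) a j.
Proof.
move=> iC Ca; elim: i => [|i IH] /=; first by rewrite big_ord1.
rewrite big_ord_recr /=; apply: le_trans (wPU_le (internalUn i iC) (iC i.+1)) _.
exact: lerD.
Qed.

(** Saturation is used twice: on the partial unions of the [C i], with the supremum of their weights
    as bound, to get [D]; and on the exceptional sets, with budgets $(e/2)2^{-(j+1)}$, to cover them
    all by one internal set. The last two clauses say that [wP D] is this supremum, which is the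
    core of countable additivity. *)
Lemma approx_bigcup (E : nat -> set (loeb P)) (C : nat -> forall n, set (T n)) :
  (forall i, lapprox (E i) (C i)) ->
  exists D, [/\ lapprox (\bigcup_i E i) D, (forall i, wP (isetUn C i) <= wP D) &
    forall e, 0 < e -> exists i, wP D - e <= wP (isetUn C i)].
Proof.
move=> aC; have iC i : internal (C i) by case: (aC i).
have iU i := internalUn i iC.
pose S : set R := range (fun i => wP (isetUn C i)).
have hS : has_sup S.
  split; first by exists (wP (isetUn C 0%N)), 0%N.
  exists 1 => _ [i _ <-]; apply: ulim_le_near (cvg_wP (iU i)) _.
  by apply: nearW => n /=; apply: pr_le1; exact: iU.
have [i|D [iD FD Dc]] := @saturation (isetUn C) (sup S) iU (@isetUn_mono C).
  by apply: ub_le_sup; [case: hS|exists i].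
have le i : wP (isetUn C i) <= wP D by apply: wP_near => //; exact: FD.
have ge e : 0 < e -> exists i, wP D - e <= wP (isetUn C i).
  move=> e0; have [_ [i _ <-] Hi] := sup_adherent e0 hS.
  by exists i; move: Hi Dc; lra.
exists D; split=> //; split=> // e e0.
have [i ie] := ge (e / 2) (divr_gt0 e0 (ltr0n _ 2)).
have pos j : 0 < e / 2 * 2^-1 ^+ j.+1 :> R.
  by rewrite mulr_gt0 ?divr_gt0// exprn_gt0// invr_gt0.
have BP j := cid ((aC j).2 _ (pos j)).
pose B j := projT1 (BP j).
have iB j : internal (B j) by rewrite /B; case: (projT2 (BP j)).
have Be j : wP (B j) <= e / 2 * 2^-1 ^+ j.+1 by rewrite /B; case: (projT2 (BP j)).
have EC j x : ~ hull (B j) x -> (E j x <-> hull (C j) x).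
  by rewrite /B; case: (projT2 (BP j)) => _ _; exact.
have iBU j := internalUn j iB.
have [j|B' [iB' BB' B'e]] := @saturation (isetUn B) (e / 2) iBU (@isetUn_mono B).
  apply: (le_trans (wPUn_le j iB Be)); rewrite -mulr_sumr.
  rewrite sum_half_expn.
  apply: ler_piMr; first by rewrite divr_ge0// ltW.
  by rewrite lerBlDr lerDl exprn_ge0// invr_ge0.
have hB j x : hull (B j) x -> hull B' x.
  move=> h; have hU : hull (isetUn B j) x by apply/hullUn; exists j.
  by apply: filterS (filterI hU (BB' j)) => n [? ]; exact.
(* Off [B'] each [E j] agrees with [hull (C j)]; off the second set, whose weight is at most [e / 2]
   by the choice of [i], a point of [hull D] lies in a partial union. *)
exists (isetU B' (isetD D (isetUn C i))); split.
- by apply: internalU => //; exact: internalD.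
- have := wPU_le iB' (internalD iD (iU i)); have := wPDI iD (iU i).
  have : wP (isetUn C i) <= wP (isetI D (isetUn C i)).
    apply: wP_near => //; first exact: internalI.
    by apply: filterS (FD i) => n h y Cy; split=> //; exact: h.
  lra.
- move=> x /hullU/not_orP[nB /hullD nD]; split=> [[j _ Ej]|Dx].
    have hC : hull (C j) x by apply/EC => // /hB.
    have hU : hull (isetUn C j) x by apply/hullUn; exists j.
    by apply: filterS (filterI hU (FD j)) => n [? ]; exact.
  have /hullUn[j ji Cj] : hull (isetUn C i) x.
    by apply: contrapT => h; apply: nD.
  by exists j => //; apply/EC => // /hB.
Qed.

Definition lmeasurable : set (set (loeb P)) := [set E | exists C, lapprox E C].

Lemma approx0 : lapprox set0 (fun=> set0).
Proof.
apply: (@approx_ext (hull (fun=> set0))); first by move=> x; split=> // /filter_ex[].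
by apply: approx_hull => n; exact: measurable0.
Qed.

Lemma lmeasurable0 : lmeasurable set0.
Proof. by exists (fun=> set0); exact: approx0. Qed.

Lemma lmeasurableC E : lmeasurable E -> lmeasurable (~` E).
Proof. by move=> [C /approxC]; exists (isetC C). Qed.

Lemma lmeasurable_bigcup (F : (set (loeb P))^nat) :
  (forall i, lmeasurable (F i)) -> lmeasurable (\bigcup_i F i).
Proof.
move=> mF; pose C i := projT1 (cid (mF i)).
have [i|D [aD _ _]] := @approx_bigcup F C; last by exists D.
exact: (projT2 (cid (mF i))).
Qed.

HB.instance Definition _ := gen_eqMixin (loeb P).
HB.instance Definition _ := gen_choiceMixin (loeb P).
HB.instance Definition _ := isPointed.Build (loeb P) (fun=> point).
HB.instance Definition _ := @isMeasurable.Build default_measure_display (loeb P)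
  lmeasurable lmeasurable0 lmeasurableC lmeasurable_bigcup.

Definition loebP E : \bar R :=
  if pselect (lmeasurable E) is left h then (wP (projT1 (cid h)))%:E else 0%E.

Lemma loebPE E C : lapprox E C -> loebP E = (wP C)%:E.
Proof.
move=> aC; rewrite /loebP; case: pselect => [h|[]]; last by exists C.
by congr EFin; apply: approx_wP aC; exact: (projT2 (cid h)).
Qed.

Lemma loebP_ge0 E : (0 <= loebP E)%E.
Proof.
rewrite /loebP; case: pselect => // h.
by rewrite lee_fin wP_ge0//; case: (projT2 (cid h)).
Qed.

Lemma loebP0 : loebP set0 = 0%E.
Proof. by rewrite (loebPE approx0) wP0. Qed.

(** Only the [F i] are disjoint; their representatives [C i] may overlap. So the intersections and
    differences of internal sets are replaced, through [approx_wP], by representatives of the right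
    unions of the [F i]. *)
Lemma loebP_sigma_additive : semi_sigma_additive loebP.
Proof.
move=> F mF tF _; pose C i := projT1 (cid (mF i)).
have aC i : lapprox (F i) (C i) := projT2 (cid (mF i)).
have iC i : internal (C i) by case: (aC i).
have iU i := internalUn i iC.
have [D [aD Dge Dle]] := approx_bigcup aC.
have aU i : lapprox (\bigcup_(j in [set j | (j <= i)%N]) F j) (isetUn C i).
  elim: i => [|i IH] /=.
    apply: approx_ext (aC 0%N) => x; split=> [Fx|[j /=]]; first by exists 0%N.
    by rewrite leqn0 => /eqP ->.
  apply: approx_ext (approxU IH (aC i.+1)) => x; split.
    move=> [[j /= ji Fj]|Fi]; last by exists i.+1 => /=.
    by exists j => //=; exact: leqW.
  move=> [j /=]; rewrite leq_eqVlt => /orP[/eqP -> ?|ji Fj]; first by right.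
  by left; exists j.
have sumE i : (\sum_(0 <= j < i.+1) loebP (F j))%E = (wP (isetUn C i))%:E.
  elim: i => [|i IH]; first by rewrite big_nat1 (loebPE (aC 0%N)).
  rewrite big_nat_recr//= IH (loebPE (aC i.+1)) -EFinD; congr EFin.
  rewrite (wPDI (internalU (iU i) (iC i.+1)) (iU i)); congr (_ + _).
    apply: (@approx_wP (\bigcup_(j in [set j | (j <= i)%N]) F j)) => //.
    apply: approx_ext (approxI (approxU (aU i) (aC i.+1)) (aU i)) => x.
    by split=> [[]//|h]; split=> //; left.
  apply: (@approx_wP (F i.+1)) => //.
  have := approxI (approxU (aU i) (aC i.+1)) (approxC (aU i)).
  apply: approx_ext => x; split=> [[[//|//]]|h]; split; first by right.
  move=> [j /= ji Fj]; move: tF => /trivIsetP /(_ j i.+1 I I).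
  rewrite ltn_eqF ?ltnS// => /(_ isT) /seteqP[/(_ x)] /=.
  by move=> + _; apply.
(* The shift drops the empty sum: [isetUn C i] corresponds to the first [i.+1] terms. *)
rewrite (loebPE aD); rewrite -(cvg_shiftS _).
rewrite (_ : [sequence _]_n = EFin \o (fun i => wP (isetUn C i))); last first.
  by apply/funext => n; exact: sumE.
apply: cvg_EFin; first exact: nearW.
apply/cvgrPdist_le => e e0; have [i ie] := Dle e e0.
exists i => // j /= ij; have := Dge j.
have : wP (isetUn C i) <= wP (isetUn C j).
  by apply: wP_near => //; apply: nearW => n; exact: isetUn_mono.
by rewrite ler_norml; lra.
Qed.

HB.instance Definition _ := isMeasure.Build _ (loeb P) R loebP loebP0 loebP_ge0
  loebP_sigma_additive.

Lemma loebPT : loebP setT = 1%E.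
Proof.
rewrite (@loebPE _ (fun=> setT)) ?wPT//.
apply: (@approx_ext (hull (fun=> setT))).
  by move=> x; split=> // _; exact: filterT.
by apply: approx_hull => n; exact: measurableT.
Qed.

HB.instance Definition _ := Measure_isProbability.Build _ (loeb P) R loebP loebPT.

End loeb.

(** * Integrals of bounded functions, and of signed binary sums *)

Section mean.
Context {R : realType} d (T : measurableType d) (Q : probability T R).
Implicit Types f g : T -> R.

Lemma Linf_le f M : measurable_fun setT f -> (forall x, `|f x| <= M) -> Linf f.
Proof. by move=> mf fM; split=> //; exists M. Qed.

Lemma Linf_bound f : Linf f -> exists2 M : R, 0 < M & forall x, `|f x| <= M.
Proof.
move=> [_ [M fM]]; exists (`|M| + 1); first by rewrite ltr_wpDl.
by move=> x; rewrite (le_trans (fM x))// (le_trans (ler_norm M))// lerDl.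
Qed.

Lemma Linf_cst (a : R) : Linf (fun _ : T => a).
Proof. by apply: (@Linf_le _ `|a|). Qed.

Lemma Linf_norm f : Linf f -> Linf (fun x => `|f x|).
Proof.
move=> [mf [M fM]]; apply: (@Linf_le _ M); first exact: measurableT_comp.
by move=> x; rewrite normr_id.
Qed.

Lemma LinfD f g : Linf f -> Linf g -> Linf (fun x => f x + g x).
Proof.
move=> [mf [M fM]] [mg [N gN]]; apply: (@Linf_le _ (M + N)).
  exact: measurable_funD.
by move=> x; rewrite (le_trans (ler_normD _ _))// lerD.
Qed.

Lemma LinfM f g : Linf f -> Linf g -> Linf (fun x => f x * g x).
Proof.
move=> [mf [M fM]] [mg [N gN]]; apply: (@Linf_le _ (M * N)).
  exact: measurable_funM.
by move=> x; rewrite normrM ler_pM.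
Qed.

Lemma LinfZ (a : R) f : Linf f -> Linf (fun x => a * f x).
Proof. exact/LinfM/Linf_cst. Qed.

Lemma LinfB f g : Linf f -> Linf g -> Linf (fun x => f x - g x).
Proof.
move=> lf lg; rewrite (_ : (fun _ => _) = (fun x => f x + (-1) * g x)).
  by apply: LinfD => //; exact: LinfZ.
by apply/funext => x; rewrite mulN1r.
Qed.

Lemma Linf_integrable f : Linf f -> Q.-integrable setT (EFin \o f).
Proof.
move=> lf; have [M M0 fM] := Linf_bound lf.
apply: measurable_bounded_integrable => //.
- exact: le_lt_trans (probability_le1 Q measurableT) (ltry 1).
- by case: lf.
- exists M; split; first exact: gtr0_real.
  by move=> N MN x _ /=; rewrite (le_trans (fM x))// ltW.
Qed.

Definition mean f : R := Rintegral Q setT f.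

Lemma integral_mean f : Linf f -> (\int[Q]_x (f x)%:E)%E = (mean f)%:E.
Proof.
by move=> lf; rewrite /mean /Rintegral fineK//; exact/integrable_fin_num/Linf_integrable.
Qed.

Lemma meanD f g : Linf f -> Linf g -> mean (fun x => f x + g x) = mean f + mean g.
Proof. by move=> lf lg; rewrite /mean RintegralD//; exact: Linf_integrable. Qed.

Lemma meanB f g : Linf f -> Linf g -> mean (fun x => f x - g x) = mean f - mean g.
Proof. by move=> lf lg; rewrite /mean RintegralB//; exact: Linf_integrable. Qed.

Lemma meanZ a f : Linf f -> mean (fun x => a * f x) = a * mean f.
Proof. by move=> lf; rewrite /mean RintegralZl//; exact: Linf_integrable. Qed.

Lemma mean_cst a : mean (fun=> a) = a.
Proof.
transitivity (a * fine (Q setT)); first exact: Rintegral_cst.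
by rewrite probability_setT mulr1.
Qed.

Lemma mean_le f g : Linf f -> Linf g -> (forall x, f x <= g x) -> mean f <= mean g.
Proof.
by move=> lf lg fg; apply: le_Rintegral => //; exact: Linf_integrable.
Qed.

Lemma norm_mean f : Linf f -> `|mean f| <= mean (fun x => `|f x|).
Proof. by move=> lf; apply: le_normr_Rintegral => //; exact: Linf_integrable. Qed.

Lemma mean_bound f e : Linf f -> (forall x, `|f x| <= e) -> `|mean f| <= e.
Proof.
move=> lf fe; apply: (le_trans (norm_mean lf)); rewrite -[leRHS](mean_cst e).
by apply: mean_le => //; [exact: Linf_norm|exact: Linf_cst].
Qed.

Lemma mean_ae f g : Linf f -> Linf g -> {ae Q, forall x, f x = g x} -> mean f = mean g.
Proof.
move=> lf lg fg; congr fine; apply: ae_eq_integral => //.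
- by apply/measurable_EFinP; case: lf.
- by apply/measurable_EFinP; case: lg.
- by apply: filterS fg => x /= -> .
Qed.

Lemma mean_le_ae f g : Linf f -> Linf g ->
  {ae Q, forall x, f x <= g x} -> mean f <= mean g.
Proof.
move=> lf lg fg; have lm : Linf (fun x => Num.max (f x) (g x)).
  have [M M0 fM] := Linf_bound lf; have [N N0 gN] := Linf_bound lg.
  apply: (@Linf_le _ (Num.max M N)).
    by apply: measurable_maxr; [case: lf|case: lg].
  by move=> x; case: (leP (f x)) => _; rewrite le_max ?fM ?gN ?orbT.
rewrite (@mean_ae g (fun x => Num.max (f x) (g x)))//.
  by apply: mean_le => // x; rewrite le_max lexx.
by apply: filterS fg => x /max_idPr ->.
Qed.

Lemma mean_norm_eq0 f : Linf f -> mean (fun x => `|f x|) = 0 -> {ae Q, forall x, f x = 0}.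
Proof.
move=> lf f0.
have : (\int[Q]_x `|(EFin \o f) x| = 0)%E.
  by have := integral_mean (Linf_norm lf); rewrite f0.
move=> h; have mf : measurable_fun setT (EFin \o f) by apply/measurable_EFinP; case: lf.
have := (ae_eq_integral_abs Q measurableT mf).1 h.
by apply: filterS => x /= /(_ I)[].
Qed.

Definition indic_sign (b : bool) : R := if b then 1 else -1.

Lemma indic_signE (B : set T) x : indic_sign `[<B x>] = 2 * \1_B x - 1.
Proof.
rewrite /indic_sign indicE; case: asboolP => Bx.
  by rewrite mem_set//=; lra.
by rewrite memNset//=; lra.
Qed.

Lemma Linf_indic (B : set T) : measurable B -> Linf (\1_B : T -> R).
Proof.
move=> mB; apply: (@Linf_le _ 1); first exact: measurable_indic.
by move=> x; rewrite indicE; case: (_ \in _); rewrite ?normr1 ?normr0.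
Qed.

Lemma Linf_sign (B : set T) : measurable B -> Linf (fun x => indic_sign `[<B x>]).
Proof.
move=> mB; rewrite (_ : (fun _ => _) = (fun x => 2 * \1_B x - 1)).
  by apply: LinfB; [apply: LinfZ; exact: Linf_indic|exact: Linf_cst].
by apply/funext => x; rewrite indic_signE.
Qed.

Lemma mean_sign (B : set T) : measurable B ->
  mean (fun x => indic_sign `[<B x>]) = 2 * pr Q B - 1.
Proof.
move=> mB; rewrite (_ : (fun _ => _) = (fun x => 2 * \1_B x - 1)); last first.
  by apply/funext => x; rewrite indic_signE.
have lB := Linf_indic mB.
rewrite meanB ?meanZ ?mean_cst//; [|exact: LinfZ|exact: Linf_cst].
by rewrite /mean /Rintegral integral_indic// setIT.
Qed.

Definition dsum J (b : nat -> bool) : R := \sum_(j < J) 2^-1 ^+ j.+1 * indic_sign (b j).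

Lemma Linf_dsum J (B : nat -> set T) : (forall j, measurable (B j)) ->
  Linf (fun x => dsum J (fun j => `[<B j x>])).
Proof.
move=> mB; elim: J => [|J IH].
  rewrite (_ : (fun _ => _) = (fun=> 0)); first exact: Linf_cst.
  by apply/funext => x; rewrite /dsum big_ord0.
rewrite (_ : (fun _ => _) = (fun x => dsum J (fun j => `[<B j x>]) +
    2^-1 ^+ J.+1 * indic_sign `[<B J x>])).
  by apply: LinfD => //; apply: LinfZ; exact: Linf_sign.
by apply/funext => x; rewrite /dsum big_ord_recr.
Qed.

(** The mean depends on the measures of the sets [B j] alone; this reduces convergence of integrals
    to convergence of measures of internal sets. *)
Lemma mean_dsum J (B : nat -> set T) : (forall j, measurable (B j)) ->
  mean (fun x => dsum J (fun j => `[<B j x>])) =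
  \sum_(j < J) 2^-1 ^+ j.+1 * (2 * pr Q (B j) - 1).
Proof.
move=> mB; elim: J => [|J IH].
  rewrite (_ : (fun _ => _) = (fun=> 0)) ?mean_cst ?big_ord0//.
  by apply/funext => x; rewrite /dsum big_ord0.
rewrite big_ord_recr/= -IH (_ : (fun _ => _) = (fun x => dsum J (fun j => `[<B j x>]) +
    2^-1 ^+ J.+1 * indic_sign `[<B J x>])); last first.
  by apply/funext => x; rewrite /dsum big_ord_recr.
rewrite meanD ?meanZ ?mean_sign//; first exact: Linf_sign.
- exact: Linf_dsum.
- by apply: LinfZ; exact: Linf_sign.
Qed.

End mean.

(* Signed binary digits: [t] in [[-1, 1]] is the sum of the [2^-(j+1)] taken with
   sign [+] if [digit j t] and [-] otherwise.  They encode a bounded function by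
   countably many sets, each of which can be lifted to an internal set. *)
Section digits.
Context {R : realType}.

(** The remainder after [j] digits, rescaled by $2^j$ so that it stays in $[-1, 1]$. *)
Fixpoint residue (j : nat) (t : R) : R :=
  if j is j'.+1 then 2 * residue j' t - indic_sign (0 <= residue j' t) else t.

Definition digit j (t : R) : bool := 0 <= residue j t.

Lemma residue_bound j t : `|t| <= 1 -> `|residue j t| <= 1.
Proof.
move=> t1; elim: j => //= j; rewrite !ler_norml /indic_sign => /andP[h1 h2].
by case: (leP 0 (residue j t)) => h; lra.
Qed.

Lemma dsum_residue J t : t = dsum J (digit^~ t) + 2^-1 ^+ J * residue J t.
Proof.
elim: J => [|J IH]; first by rewrite /dsum big_ord0 add0r mul1r.
rewrite [LHS]IH /dsum big_ord_recr/= -addrA; congr (_ + _).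
by rewrite /digit exprSr; set a := _ ^+ J; lra.
Qed.

Lemma dsum_digit J t : `|t| <= 1 -> `|t - dsum J (digit^~ t)| <= 2^-1 ^+ J.
Proof.
move=> t1; rewrite {1}(dsum_residue J t) addrAC subrr add0r normrM.
have a0 : 0 <= 2^-1 ^+ J :> R by rewrite exprn_ge0// invr_ge0.
by rewrite (ger0_norm a0) ler_piMr// residue_bound.
Qed.

Lemma norm_digit_term j (b : bool) : `|2^-1 ^+ j * indic_sign b| = 2^-1 ^+ j :> R.
Proof.
rewrite normrM /indic_sign; have -> : `|if b then 1 else -1| = 1 :> R.
  by case: b; rewrite ?normrN normr1.
by rewrite mulr1 ger0_norm// exprn_ge0// invr_ge0.
Qed.

(** Stated for arbitrary bits, since those in [loeb_lift1] come from approximating internal sets and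
    not from [digit]. *)
Lemma dsum_tail J n (b : nat -> bool) : (J <= n)%N ->
  `|dsum n b - dsum J b| <= 2^-1 ^+ J :> R.
Proof.
move=> /subnKC <-; set k := (n - J)%N.
suff : `|dsum (J + k) b - dsum J b| <= 2^-1 ^+ J - 2^-1 ^+ (J + k) :> R.
  by move/le_trans; apply; rewrite lerBlDr lerDl exprn_ge0// invr_ge0.
elim: k => [|k IH]; first by rewrite addn0 !subrr normr0.
rewrite addnS /dsum big_ord_recr/= -/(dsum _ _) addrAC.
apply: (le_trans (ler_normD _ _)); rewrite norm_digit_term.
by move: IH; rewrite exprS /dsum; set a := _ ^+ (J + k); lra.
Qed.

Lemma dsum_bound J (b : nat -> bool) : `|dsum J b| <= 1 :> R.
Proof. by have := dsum_tail b (leq0n J); rewrite {2}/dsum big_ord0 subr0. Qed.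

Lemma measurable_residue j : measurable_fun setT (residue j).
Proof.
elim: j => [|j IH] /=; first exact: measurable_id.
apply: measurable_funB; first exact: measurable_funM.
have -> : (fun t => indic_sign (0 <= residue j t)) =
    (fun t => indic_sign `[<(residue j @^-1` `[0, +oo[) t>]) :> (R -> R).
  by apply/funext => t; congr indic_sign; apply/idP/asboolP;
     rewrite /= in_itv/= andbT.
apply: (proj1 (Linf_sign _)).
by rewrite -[X in measurable X]setTI; exact: IH.
Qed.

Lemma measurable_digit d (T : measurableType d) (f : T -> R) j :
  measurable_fun setT f -> measurable [set x | digit j (f x)].
Proof.
move=> mf; have -> : [set x | digit j (f x)] = (residue j \o f) @^-1` `[0, +oo[.
  by apply/seteqP; split=> x /=; rewrite in_itv/= andbT.
rewrite -[X in measurable X]setTI.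
by apply: (measurableT_comp (measurable_residue j) mf).
Qed.

Lemma half_expn_small (e : R) : 0 < e -> exists J, 2^-1 ^+ J <= e.
Proof.
move=> e0; have : 2^-1 ^+ n @[n --> \oo] --> (0 : R).
  by apply: cvg_expr; rewrite ger0_norm ?invr_ge0//; lra.
move/cvgrPdist_le => /(_ _ e0)[J _ HJ]; exists J; have := HJ J (leqnn J) => /=.
by rewrite sub0r normrN ger0_norm// exprn_ge0// invr_ge0.
Qed.

End digits.

(** * Standard parts of internal functions: measurability, integrals, lifting *)

Section standard_part.
Context {R : realType} (d : nat -> measure_display)
  (T : forall n, measurableType (d n)) (P : forall n, probability (T n) R).
Implicit Types (f g : forall n, T n -> R) (C : forall n, set (T n)).
Local Notation mu := (@loebP _ _ _ P : probability (loeb P) R).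

Definition st f : loeb P -> R := fun x => ulim (fun n => f n (x n)).

Definition ibounded (M : R) f :=
  (forall n, measurable_fun setT (f n)) /\ forall n y, `|f n y| <= M.

Lemma ibounded_Linf M f n : ibounded M f -> Linf (f n).
Proof. by move=> [mf fM]; apply: (@Linf_le _ _ _ _ M). Qed.

Lemma cvg_st M f x : ibounded M f -> (fun n => f n (x n)) @ ultra --> st f x.
Proof. by move=> [_ fM]; apply: (@cvg_ulim _ _ M) => n. Qed.

Lemma st_bound M f x : ibounded M f -> `|st f x| <= M.
Proof.
move=> fM; apply: (@ulim_le_near _ (fun n => `|f n (x n)|)).
  by apply: cvg_norm; exact: cvg_st fM.
by apply: nearW => n; exact: fM.2.
Qed.

Lemma measurable_hull C : internal C -> measurable (hull C : set (loeb P)).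
Proof. by move=> iC; exists C; exact: approx_hull. Qed.

Lemma mu_hull C : internal C -> mu (hull C) = (wP P C)%:E.
Proof. by move=> iC; apply: (loebPE (approx_hull P iC)). Qed.

Lemma pr_hull C : internal C -> pr mu (hull C) = wP P C.
Proof. by move=> iC; rewrite /pr mu_hull. Qed.

Definition dset f j n : set (T n) := [set y | digit j (f n y)].
Arguments dset f j n _ : clear implicits.

Lemma internal_dset M f j : ibounded M f -> internal (dset f j).
Proof. by move=> [mf _] n; exact: measurable_digit. Qed.

Lemma ultra_digit f J x :
  ultra [set n | forall j : 'I_J, digit j (f n (x n)) = `[<hull (P := P) (dset f j) x>]].
Proof.
apply: filter_forall => j; case: asboolP => [h|/hullC h]; apply: filterS h => n.
  by [].
by move=> /negP/negbTE.
Qed.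

Lemma dsum_eq J (b b' : nat -> bool) : (forall j : 'I_J, b j = b' j) ->
  dsum J b = dsum J b' :> R.
Proof. by move=> bb'; apply: eq_bigr => j _; rewrite bb'. Qed.

(** The bits given by the hulls are ultralimits of the digits of [f n (x n)]. They need not be the
    digits of [st f x], because [digit] is discontinuous, yet their sums approximate it uniformly in
    [x]; hence [st f] is measurable. *)
Lemma st_dsum f x J : ibounded 1 f ->
  `|st f x - dsum J (fun j => `[<hull (P := P) (dset f j) x>])| <= 2^-1 ^+ J.
Proof.
move=> f1; set D := dsum _ _.
apply: (@ulim_le_near _ (fun n => `|f n (x n) - D|)).
  by apply: cvg_norm; apply: cvgB; [exact: cvg_st f1|exact: cvg_cst].
apply: filterS (ultra_digit f J x) => n /= H.
rewrite /D -(dsum_eq (b := digit^~ (f n (x n))))//.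
by apply: dsum_digit; exact: f1.2.
Qed.

Lemma measurable_st1 f : ibounded 1 f -> measurable_fun setT (st f).
Proof.
move=> f1.
apply: (@measurable_fun_cvg _ _ _ setT
  (fun J x => dsum J (fun j => `[<hull (P := P) (dset f j) x>]))).
  move=> J; apply: (proj1 (Linf_dsum _ _)) => j.
  by apply: measurable_hull; exact: internal_dset f1.
move=> x _; apply/cvgrPdist_le => e e0; have [J HJ] := half_expn_small e0.
exists J => // k /= Jk; apply: (le_trans (st_dsum x k f1)); apply: le_trans HJ.
by apply: ler_wiXn2l => //; rewrite ?invr_ge0// invf_le1// ler1n.
Qed.

Lemma st_scale M (a : R) f x : ibounded M f -> st (fun n y => a * f n y) x = a * st f x.
Proof. by move=> fM; apply: ulimE; apply: cvgM; [exact: cvg_cst|exact: cvg_st fM]. Qed.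

Lemma ibounded_scale M (a : R) f : ibounded M f -> ibounded (`|a| * M) (fun n y => a * f n y).
Proof.
move=> [mf fM]; split=> [n|n y]; first exact: measurable_funM.
by rewrite normrM ler_wpM2l.
Qed.

Lemma ibounded_gt0 M f : ibounded M f -> exists2 N, 0 < N & ibounded N f.
Proof.
move=> [mf fM]; exists (`|M| + 1); first by rewrite ltr_wpDl.
by split=> // n y; rewrite (le_trans (fM n y))// (le_trans (ler_norm M))// lerDl.
Qed.

Lemma ibounded_unit M f : 0 < M -> ibounded M f -> ibounded 1 (fun n y => M^-1 * f n y).
Proof.
move=> M0 fM; have := ibounded_scale M^-1 fM.
by rewrite gtr0_norm ?invr_gt0// mulVf// gt_eqF.
Qed.

Lemma st_unit M f : 0 < M -> ibounded M f ->
  st f = (fun x => M * st (fun n y => M^-1 * f n y) x).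
Proof.
move=> M0 fM; apply/funext => x.
by rewrite (st_scale _ _ fM) mulrA divff ?mul1r// gt_eqF.
Qed.

Lemma Linf_st M f : ibounded M f -> Linf (st f).
Proof.
move=> fM; apply: (@Linf_le _ _ _ _ M); last by move=> x; exact: st_bound.
have [N N0 fN] := ibounded_gt0 fM; rewrite (st_unit N0 fN).
apply: measurable_funM; first exact: measurable_cst.
exact/measurable_st1/ibounded_unit.
Qed.

Lemma mean_dsum_bound d' (X : measurableType d') (Q : probability X R)
    (h : X -> R) (B : nat -> set X) (J : nat) (e : R) :
  Linf h -> (forall j, measurable (B j)) ->
  (forall x, `|h x - dsum J (fun j => `[<B j x>])| <= e) ->
  `|mean Q h - \sum_(j < J) 2^-1 ^+ j.+1 * (2 * pr Q (B j) - 1)| <= e.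
Proof.
move=> lh mB he; rewrite -mean_dsum// -meanB//; last exact: Linf_dsum.
by apply: mean_bound => //; apply: LinfB => //; exact: Linf_dsum.
Qed.

(** On both sides the mean is within $2^{-J}$ of the same finite linear expression in the measures
    of the digit sets, and these measures converge. *)
Lemma cvg_mean1 f : ibounded 1 f -> (fun n => mean (P n) (f n)) @ ultra --> mean mu (st f).
Proof.
move=> f1; apply/cvgrPdist_le => e e0.
have e3 : 0 < e / 3 by rewrite divr_gt0.
have [J HJ] := half_expn_small e3.
have iD j := internal_dset j f1.
pose S n := \sum_(j < J) 2^-1 ^+ j.+1 * (2 * pr (P n) (dset f j n) - 1).
pose S' := \sum_(j < J) 2^-1 ^+ j.+1 * (2 * pr mu (hull (dset f j)) - 1).
have cS : S @ ultra --> S'.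
  apply: (@cvg_bigsum _ 'I_J) => j.
  apply: cvgM; first exact: cvg_cst.
  apply: cvgB; last exact: cvg_cst.
  apply: cvgM; first exact: cvg_cst.
  by rewrite pr_hull//; apply: cvg_wP; exact: iD.
have H1 : `|mean mu (st f) - S'| <= 2^-1 ^+ J.
  have mD j : measurable (hull (dset f j) : set (loeb P)) by exact: measurable_hull.
  apply: (@mean_dsum_bound _ _ mu (st f) (fun j => hull (dset f j)) J _ (Linf_st f1) mD).
  move=> x.
  exact: st_dsum.
have H2 n : `|mean (P n) (f n) - S n| <= 2^-1 ^+ J.
  apply: (@mean_dsum_bound _ _ (P n) (f n) (fun j => dset f j n) J _
    (ibounded_Linf n f1) (fun j => iD j n)) => y.
  rewrite -(dsum_eq (b := digit^~ (f n y))).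
    by apply: dsum_digit; exact: f1.2.
  by move=> j; apply/idP/asboolP.
have := near_ulimB e3 cS; apply: filterS => n /= H3.
have := H2 n; move: H1 H3 HJ; rewrite !ler_norml => /andP[? ?] /andP[? ?] ? /andP[? ?].
by apply/andP; split; lra.
Qed.

Lemma cvg_mean M f : ibounded M f -> (fun n => mean (P n) (f n)) @ ultra --> mean mu (st f).
Proof.
move=> fM; have [N N0 fN] := ibounded_gt0 fM; have f1 := ibounded_unit N0 fN.
rewrite (st_unit N0 fN) meanZ; last exact: Linf_st f1.
rewrite (_ : (fun n => _) = (fun n => N * mean (P n) (fun y => N^-1 * f n y))).
  apply: cvgM; first exact: cvg_cst.
  exact: cvg_mean1.
apply/funext => n; rewrite meanZ; last exact: ibounded_Linf fM.
by rewrite mulrA divff ?mul1r// gt_eqF.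
Qed.

(** The null sets of the coordinates form an internal set of weight the limit of 0. *)
Lemma ae_internal (p : forall n, T n -> Prop) :
  (forall n, {ae P n, forall y, p n y}) ->
  {ae mu, forall x : loeb P, ultra [set n | p n (x n)]}.
Proof.
move=> aep; pose N n := projT1 (cid (aep n)).
have NP n : [/\ measurable (N n), P n (N n) = 0%E & ~` [set y | p n y] `<=` N n].
  exact: (projT2 (cid (aep n))).
have iN : internal N by move=> n; case: (NP n).
exists (hull N); split; first exact: measurable_hull.
  rewrite mu_hull// /wP (_ : (fun _ => _) = fun=> 0) ?ulim_cst//.
  by apply/funext => n; rewrite /pr; case: (NP n) => _ ->.
move=> x /= /ultraNP; apply: filterS => n /= np.
by case: (NP n) => _ _; apply.
Qed.

(** The sets that witness [lapprox E C] also show that the symmetric difference is approximated by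
    the empty family. *)
Lemma approx_null (E : set (loeb P)) C :
  lapprox E C -> mu.-negligible ((E `\` hull C) `|` (hull C `\` E)).
Proof.
move=> [iC aC]; have a0 : lapprox ((E `\` hull C) `|` (hull C `\` E)) (fun=> set0).
  split=> [n|e /aC[D [iD De HD]]]; first exact: measurable0.
  exists D; split=> // x /HD EC; split=> [[[Ex Cx]|[Cx Ex]]|/filter_ex[]//].
    by case: Cx; exact/EC.
  by case: Ex; exact/EC.
exists ((E `\` hull C) `|` (hull C `\` E)); split=> //; first by exists (fun=> set0).
by apply: eq_trans (loebPE a0) _; rewrite wP0.
Qed.

Lemma loeb_lift1 (v : loeb P -> R) : measurable_fun setT v -> (forall x, `|v x| <= 1) ->
  exists2 f, ibounded 1 f & {ae mu, forall x, st f x = v x}.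
Proof.
move=> mv v1; have mD j : measurable [set x | digit j (v x)] by exact: measurable_digit.
pose C j := projT1 (cid (mD j)).
have aC j : lapprox [set x | digit j (v x)] (C j) := projT2 (cid (mD j)).
have iC j : internal (C j) by case: (aC j).
(* Each digit set of [v] is replaced by an internal set. Coordinate [n] uses [n] bits, so that along
   [ultra] any fixed accuracy is reached. *)
exists (fun n y => dsum n (fun j => `[<C j n y>])).
  split=> [n|n y]; last exact: dsum_bound.
  by apply: (proj1 (Linf_dsum _ _)) => j; exact: iC.
have : {ae mu, forall x, forall j, hull (C j) x <-> digit j (v x)}.
  apply/ae_foralln => j; apply: negligibleS (approx_null (aC j)) => x /= h.
  apply: contrapT => /not_orP[/= /not_andP h1 /not_andP h2]; apply: h; split.
    by move=> hC; case: h2 => // /contrapT.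
  by move=> hv; case: h1 => // /contrapT.
apply: filterS => x H; apply: ulimE; apply/cvgrPdist_le => e e0.
have e2 : 0 < e / 2 by rewrite divr_gt0.
have [J HJ] := half_expn_small e2.
have : ultra [set n | forall j : 'I_J, `[<C j n (x n)>] = digit j (v x)].
  apply: filter_forall => j; have := H j; case: (digit j (v x)) => h.
    by apply: filterS (h.2 isT) => n; exact: asboolT.
  have /hullC : ~ hull (C j) x by move/h.
  by apply: filterS => n; exact: asboolF.
move=> /(filterI (ultra_ge J)); apply: filterS => n /= [Jn Hn].
have A1 := dsum_digit J (v1 x).
have A2 := dsum_tail (R := R) (fun j => `[<C j n (x n)>]) Jn.
have Hd : dsum J (fun j => `[<C j n (x n)>]) = dsum J (digit^~ (v x)) :> R.
  exact: dsum_eq.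
rewrite Hd in A2.
move: A1 A2; rewrite !ler_norml => /andP[? ?] /andP[? ?].
by apply/andP; split; lra.
Qed.

Lemma loeb_lift (v : loeb P -> R) M : measurable_fun setT v -> (forall x, `|v x| <= M) ->
  exists2 f, ibounded M f & {ae mu, forall x, st f x = v x}.
Proof.
move=> mv vM; have M0 : 0 <= M by apply: le_trans (vM point).
(* Rescaling to the bound 1 divides by [M]. *)
have [M1|M1] := eqVneq M 0.
  exists (fun n y => 0); first by split=> // n y; rewrite normr0.
  apply: aeW => x; have := vM x; rewrite M1 normr_le0 => /eqP ->.
  by rewrite /st ulim_cst.
have Mgt0 : 0 < M by rewrite lt0r M1.
have [|x|f f1 fv] := @loeb_lift1 (fun x => M^-1 * v x).
- by apply: measurable_funM.
- by rewrite normrM ger0_norm ?invr_ge0// mulrC ler_pdivrMr// mul1r.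
exists (fun n y => M * f n y).
  by have := ibounded_scale M f1; rewrite mulr1 ger0_norm.
apply: filterS fv => x fv; rewrite (st_scale _ _ f1) fv mulrA divff ?mul1r//.
Qed.

End standard_part.

Arguments cvg_mean {R d T} P {M f} _.
Arguments Linf_st {R d T} P {M f} _.
Arguments dset {R d T} f j n _.

(** * Markov graphops contract the sup norm and the $L^1$ norm *)

Section markov.
Context {R : realType} d (T : measurableType d) (Q : probability T R).
Variable A : (T -> R) -> (T -> R).
Hypothesis mA : markov_graphop Q A.

Lemma markov_lin (a b : R) v w : Linf v -> Linf w ->
  {ae Q, forall x, A (fun y => a * v y + b * w y) x = a * A v x + b * A w x}.
Proof. by case: mA => -[_ _ lin _] _ _ _; exact: lin. Qed.

Lemma markov_pos v : Linf v -> (forall x, 0 <= v x) -> {ae Q, forall x, 0 <= A v x}.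
Proof. by case: mA => _ _ pos _ lv v0; apply: pos => //; exact: aeW. Qed.

Lemma markov_measurable v : Linf v -> measurable_fun setT (A v).
Proof. by case: mA => -[_ H _ _] _ _ _ /H[]. Qed.

(** Positivity applied to $w + v$ and $w - v$; the scalar [b] of modulus 1 treats both signs at
    once. *)
Lemma markov_le v w : Linf v -> Linf w -> (forall x, `|v x| <= w x) ->
  {ae Q, forall x, `|A v x| <= A w x}.
Proof.
move=> lv lw vw.
have H (b : R) : `|b| = 1 -> {ae Q, forall x, 0 <= A w x + b * A v x}.
  move=> b1; have := markov_lin 1 b lw lv.
  have : {ae Q, forall x, 0 <= A (fun y => 1 * w y + b * v y) x}.
    apply: markov_pos; first by apply: LinfD; exact: LinfZ.
    move=> x; have := vw x; rewrite mul1r -{1}(mul1r `|_|) -b1 -normrM.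
    by rewrite ler_norml => /andP[]; lra.
  by apply: filterS2 => x h1 h2; move: h1; rewrite h2 mul1r.
have h1 := H 1 (normr1 _); have h2 := H (-1) (normrN1 _).
by apply: filterS2 h1 h2 => x; rewrite ler_norml; lra.
Qed.

Lemma markov_contraction v M : Linf v -> (forall x, `|v x| <= M) ->
  {ae Q, forall x, `|A v x| <= M}.
Proof.
move=> lv vM; have l1 : Linf (fun _ : T => 1 : R) by exact: Linf_cst.
have := markov_le lv (LinfZ M l1).
rewrite /= mulr1 => /(_ vM).
(* Homogeneity is linearity with second coefficient 0; with 1-regularity it makes the image of the
   constant [M] equal to [M]. *)
have := markov_lin M 0 l1 l1; case: mA => _ _ _.
rewrite /one_regular; apply: filterS3 => x h1 + h2.
rewrite (_ : (fun _ => _) = (fun=> M * 1)); last by apply/funext => y; rewrite mul0r addr0.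
by rewrite h1 mul0r addr0 mulr1 => <-.
Qed.

(** The image is bounded by [M] only almost everywhere, whereas [Linf] and [ibounded] ask for a
    bound at every point; truncating at $\pm M$ changes it on a null set. *)
Lemma markov_version v M : Linf v -> (forall x, `|v x| <= M) -> exists g : T -> R,
  [/\ measurable_fun setT g, forall x, `|g x| <= M & {ae Q, forall x, g x = A v x}].
Proof.
move=> lv vM; have M0 : 0 <= M by apply: le_trans (vM point).
exists (fun x => Num.min M (Num.max (- M) (A v x))); split.
- apply: measurable_minr; first exact: measurable_cst.
  by apply: measurable_maxr; [exact: measurable_cst|exact: markov_measurable].
- by move=> x; rewrite ler_norml le_min ge_min lexx le_max lexx /= andbT; lra.
- apply: filterS (markov_contraction lv vM) => x.
  by rewrite ler_norml => /andP[? ?]; rewrite max_r// min_r.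
Qed.

Lemma pairing_mean v w g : Linf v -> Linf w -> Linf g ->
  {ae Q, forall x, g x = A v x} -> pairing Q A v w = (mean Q (fun x => g x * w x))%:E.
Proof.
move=> lv lw lg gA; rewrite -integral_mean; last exact: LinfM.
apply: ae_eq_integral => //.
- by apply/measurable_EFinP/measurable_funM; [exact: markov_measurable|case: lw].
- by apply/measurable_EFinP; case: (LinfM lg lw).
- by apply: filterS gA => x /= ->.
Qed.

(** $|vA| \le |v|A$ almost everywhere, and self-adjointness against the constant 1 turns $\int |v|A$
    into $\int |v|$. *)
Lemma markov_L1 v g : Linf v -> Linf g -> {ae Q, forall x, g x = A v x} ->
  mean Q (fun x => `|g x|) <= mean Q (fun x => `|v x|).
Proof.
move=> lv lg gA; have l1 : Linf (fun _ : T => 1 : R) by exact: Linf_cst.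
have ln := Linf_norm lv; have [M M0 vM] := Linf_bound ln.
have [h [mh hM hA]] := markov_version ln vM.
have lh : Linf h := Linf_le mh hM.
have -> : mean Q (fun x => `|v x|) = mean Q h.
  have sa : pairing Q A (fun x => `|v x|) (fun=> 1) = pairing Q A (fun=> 1) (fun x => `|v x|).
    by case: mA => _ + _ _; apply.
  rewrite (pairing_mean ln l1 lh hA) (@pairing_mean _ _ (fun=> 1)) // in sa; last first.
    by case: mA => _ _ _; apply: filterS => x ->.
  case: sa => sa; transitivity (mean Q (fun x => 1 * `|v x|)).
    by congr mean; apply/funext => x; rewrite mul1r.
  by rewrite -sa; congr mean; apply/funext => x; rewrite mulr1.
apply: mean_le_ae => //; first exact: Linf_norm.
have := markov_le lv ln (fun x => lexx _).
by apply: filterS3 gA hA => x -> ->.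
Qed.

End markov.

(** * The limit operator on the Loeb space is a Markov graphop *)

Section loeb_operator.
Context {R : realType} (G : nat -> MarkovGraphop R).
Local Notation T n := (mg_T (G n)).
Local Notation P := (fun n => mg_P (G n)).
Local Notation Om := (loeb P).
Local Notation mu := (@loebP _ _ _ P : probability (loeb P) R).
Implicit Types (f g : forall n, T n -> R) (v w : Om -> R).

Definition image_family f g := 
  forall n, {ae mg_P (G n), forall y, g n y = @mg_A R (G n) (f n) y}.

Lemma image_exists M f : ibounded M f -> exists2 g, ibounded M g & image_family f g.
Proof.
move=> fM; have H n := cid (markov_version (mg_markov (G n)) (ibounded_Linf n fM) (fM.2 n)).
exists (fun n => projT1 (H n)).
  by split=> n; case: (projT2 (H n)).
by move=> n; case: (projT2 (H n)).
Qed.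

Lemma ibounded_lin M N (a b : R) f g : ibounded M f -> ibounded N g ->
  ibounded (`|a| * M + `|b| * N) (fun n y => a * f n y + b * g n y).
Proof.
move=> fM gN; have [m1 b1] := ibounded_scale a fM; have [m2 b2] := ibounded_scale b gN.
split=> [n|n y]; first exact: measurable_funD.
by rewrite (le_trans (ler_normD _ _))// lerD.
Qed.

Lemma st_lin M N (a b : R) f g (x : Om) : ibounded M f -> ibounded N g ->
  st (fun n y => a * f n y + b * g n y) x = a * st f x + b * st g x.
Proof.
move=> fM gN; apply: ulimE; apply: cvgD.
  by apply: cvgM; [exact: cvg_cst|exact: cvg_st fM].
by apply: cvgM; [exact: cvg_cst|exact: cvg_st gN].
Qed.

Lemma ibounded_norm M f : ibounded M f -> ibounded M (fun n y => `|f n y|).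
Proof.
move=> [mf fM]; split=> [n|n y]; first exact: measurableT_comp.
by rewrite normr_id.
Qed.

Lemma st_norm M f (x : Om) : ibounded M f -> st (fun n y => `|f n y|) x = `|st f x|.
Proof. by move=> fM; apply: ulimE; apply: cvg_norm; exact: cvg_st fM. Qed.

Lemma ibounded_mul M N f g : ibounded M f -> ibounded N g ->
  ibounded (M * N) (fun n y => f n y * g n y).
Proof.
move=> [mf fM] [mg gN]; split=> [n|n y]; first exact: measurable_funM.
by rewrite normrM ler_pM.
Qed.

Lemma st_mul M N f g (x : Om) : ibounded M f -> ibounded N g ->
  st (fun n y => f n y * g n y) x = st f x * st g x.
Proof.
by move=> fM gN; apply: ulimE; apply: cvgM; [exact: cvg_st fM|exact: cvg_st gN].
Qed.

Lemma image_lin M M' (a b : R) f f' g g' : ibounded M f -> ibounded M' f' ->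
  image_family f g -> image_family f' g' ->
  image_family (fun n y => a * f n y + b * f' n y) (fun n y => a * g n y + b * g' n y).
Proof.
move=> fM fM' fg fg' n.
have := markov_lin (mg_markov (G n)) a b (ibounded_Linf n fM) (ibounded_Linf n fM').
by apply: filterS3 (fg n) (fg' n) => y -> -> ->.
Qed.

Lemma image_L1 M N f g : ibounded M f -> ibounded N g -> image_family f g ->
  mean mu (fun x => `|st g x|) <= mean mu (fun x => `|st f x|).
Proof.
move=> fM gN fg.
have cf := cvg_mean P (ibounded_norm fM); have cg := cvg_mean P (ibounded_norm gN).
have -> : (fun x : Om => `|st g x|) = st (fun n y => `|g n y|).
  by apply/funext => x; rewrite (st_norm _ gN).
have -> : (fun x : Om => `|st f x|) = st (fun n y => `|f n y|).
  by apply/funext => x; rewrite (st_norm _ fM).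
apply: ler_cvg_to cg cf _; apply: nearW => n /=.
exact: (markov_L1 (mg_markov (G n)) (ibounded_Linf n fM) (ibounded_Linf n gN) (fg n)).
Qed.

(** Apply the $L^1$ bound to the differences: almost everywhere equality in the limit is exactly
    vanishing of the mean of the absolute value. *)
Lemma image_unique M M' N N' f f' g g' :
  ibounded M f -> ibounded M' f' -> ibounded N g -> ibounded N' g' ->
  image_family f g -> image_family f' g' ->
  {ae mu, forall x, st f x = st f' x} -> {ae mu, forall x, st g x = st g' x}.
Proof.
move=> fM fM' gN gN' fg fg' ff'.
have b1 := ibounded_lin 1 (-1) fM fM'; have b2 := ibounded_lin 1 (-1) gN gN'.
have := image_L1 b1 b2 (image_lin 1 (-1) fM fM' fg fg').
rewrite (@mean_ae _ _ _ _ (fun x => `|st (fun n y => 1 * f n y + -1 * f' n y) x|) (fun=> 0)).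
- rewrite mean_cst => le0.
  have l2 := Linf_st P b2.
  have : mean mu (fun x => `|st (fun n y => 1 * g n y + -1 * g' n y) x|) = 0.
    apply/eqP; rewrite eq_le le0 /= -[leLHS](mean_cst mu 0).
    by apply: mean_le => //; [exact: Linf_cst|exact: Linf_norm].
  move/(mean_norm_eq0 l2); apply: filterS => x.
  by rewrite (st_lin _ _ _ gN gN') mul1r mulN1r => /subr0_eq.
- exact/Linf_norm/(Linf_st P b1).
- exact: Linf_cst.
- apply: filterS ff' => x e.
  by rewrite (st_lin _ _ _ fM fM') e mul1r mulN1r subrr normr0.
Qed.

Lemma op_exists v : Linf v -> exists u : Om -> R, exists M f g,
  [/\ ibounded M f, ibounded M g, image_family f g,
      {ae mu, forall x, st f x = v x} & u = st g].
Proof.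
move=> lv; have [M M0 vM] := Linf_bound lv.
have [f fM fv] := loeb_lift lv.1 vM; have [g gM fg] := image_exists fM.
by exists (st g), M, f, g.
Qed.

Definition loeb_op v : Om -> R :=
  if pselect (Linf v) is left h then projT1 (cid (op_exists h)) else fun=> 0.

Lemma loeb_opP v : Linf v -> exists M f g,
  [/\ ibounded M f, ibounded M g, image_family f g,
      {ae mu, forall x, st f x = v x} & loeb_op v = st g].
Proof.
move=> lv; rewrite /loeb_op; case: pselect => // h.
exact: (projT2 (cid (op_exists h))).
Qed.

(** [loeb_op] is built from a chosen lift and a chosen image; this allows computing it, almost
    everywhere, from any others. *)
Lemma loeb_op_st v M N f g : Linf v -> ibounded M f -> ibounded N g ->
  image_family f g -> {ae mu, forall x, st f x = v x} ->
  {ae mu, forall x, loeb_op v x = st g x}.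
Proof.
move=> lv fM gN fg fv; have [M' [f' [g' [fM' gN' fg' fv' ->]]]] := loeb_opP lv.
apply: (image_unique fM' fM gN' gN fg' fg).
by apply: filterS2 fv fv' => x -> ->.
Qed.

Lemma Linf_loeb_op v : Linf v -> Linf (loeb_op v).
Proof. by move=> /loeb_opP[M [f [g [_ gM _ _ ->]]]]; exact: Linf_st gM. Qed.

Lemma loeb_op_markov : markov_graphop mu loeb_op.
Proof.
split.
- split.
  + move=> v w lv lw vw; have [M [f [g [fM gM fg fv ->]]]] := loeb_opP lv.
    have : {ae mu, forall x, st f x = w x} by apply: filterS2 fv vw => x -> ->.
    by move/(loeb_op_st lw fM gM fg); apply: filterS => x ->.
  + move=> v lv; have lo := Linf_loeb_op lv.
    by split; [case: lo|exact: Linf_integrable].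
  + move=> a b v w lv lw.
    have [M [f [g [fM gM fg fv ->]]]] := loeb_opP lv.
    have [N [f' [g' [fN gN fg' fw ->]]]] := loeb_opP lw.
    have b1 := ibounded_lin a b fM fN; have b2 := ibounded_lin a b gM gN.
    have lvw : Linf (fun y => a * v y + b * w y) by apply: LinfD; exact: LinfZ.
    apply: filterS (loeb_op_st lvw b1 b2 (image_lin a b fM fN fg fg') _) => [x ->|].
      by rewrite (st_lin _ _ _ gM gN).
    by apply: filterS2 fv fw => x h1 h2; rewrite (st_lin _ _ _ fM fN) h1 h2.
  + exists 1 => v C lv vC; have lo := Linf_loeb_op lv.
    have [M [f [g [fM gM fg fv E]]]] := loeb_opP lv.
    have := integral_mean mu (Linf_norm lo) => /= ->.
    rewrite lee_fin mul1r E; apply: (le_trans (image_L1 fM gM fg)).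
    rewrite -[leRHS](mean_cst mu C); apply: mean_le_ae.
    * exact/Linf_norm/(Linf_st P fM).
    * exact: Linf_cst.
    * by apply: filterS2 fv vC => x ->.
- move=> v w lv lw.
  have [M [f [g [fM gM fg fv Ev]]]] := loeb_opP lv.
  have [N [f' [g' [fN gN fg' fw Ew]]]] := loeb_opP lw.
  (* Used for both orders of the pairing: it becomes the mean of a standard part, hence an
     ultralimit of pairings of the [G n], where self-adjointness is known. *)
  have H (u u' : Om -> R) K K' h' k : Linf u -> Linf u' -> ibounded K' h' ->
      ibounded K k -> loeb_op u = st k -> {ae mu, forall x, st h' x = u' x} ->
      pairing mu loeb_op u u' = (mean mu (st (fun n y => k n y * h' n y)))%:E.
    move=> lu lu' hK' kK Eu hu'; rewrite /pairing Eu.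
    have lk : Linf (st k : Om -> R) := Linf_st P kK.
    have -> := integral_mean mu (LinfM lk lu'); congr EFin.
    apply: mean_ae; [exact: LinfM|exact/(Linf_st P (ibounded_mul kK hK'))|].
    by apply: filterS hu' => x e; rewrite (st_mul _ kK hK') e.
  rewrite (H v w M N f' g)// (H w v N M f g')//; congr EFin.
  have c1 := cvg_mean P (ibounded_mul gM fN); have c2 := cvg_mean P (ibounded_mul gN fM).
  rewrite -(ulimE c1) -(ulimE c2); congr (lim (_ @ ultra)); apply/funext => n.
  have lf := ibounded_Linf n fM; have lf' := ibounded_Linf n fN.
  have lg := ibounded_Linf n gM; have lg' := ibounded_Linf n gN.
  apply: EFin_inj; rewrite -(pairing_mean (mg_markov (G n)) lf lf' lg (fg n)).
  rewrite -(pairing_mean (mg_markov (G n)) lf' lf lg' (fg' n)).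
  by case: (mg_markov (G n)) => _ + _ _; apply.
- move=> v lv v0; have [M [f [g [fM gM fg fv E]]]] := loeb_opP lv.
  (* The lift [f] may take negative values. Its absolute value still lifts [v], as [v] is
     nonnegative almost everywhere, and has nonnegative images in every coordinate. *)
  have bn := ibounded_norm fM; have [h hM fh] := image_exists bn.
  have : {ae mu, forall x, st (fun n y => `|f n y|) x = v x}.
    by apply: filterS2 fv v0 => x e v0; rewrite (st_norm _ fM) e ger0_norm.
  move/(loeb_op_st lv bn hM fh).
  have : {ae mu, forall x : Om, ultra [set n | 0 <= h n (x n)]}.
    apply: (ae_internal (p := fun n y => 0 <= h n y)) => n.
    have := markov_pos (mg_markov (G n)) (ibounded_Linf n bn) (fun x => normr_ge0 _).
    by apply: filterS2 (fh n) => y ->.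
  apply: filterS2 => x h0 ->.
  have c0 : (fun _ : nat => 0 : R) @ ultra --> (0 : R) by exact: cvg_cst.
  exact: (ler_cvg_to c0 (@cvg_st _ _ _ P _ _ x hM) h0).
- have b1 : ibounded 1 (fun n (_ : T n) => 1 : R) by split=> // n y; rewrite normr1.
  have im1 : image_family (fun n (_ : T n) => 1 : R) (fun n (_ : T n) => 1 : R).
    by move=> n; case: (mg_markov (G n)) => _ _ _; apply: filterS => y ->.
  have st1 (x : Om) : st (fun n (_ : T n) => 1 : R) x = 1 by rewrite /st ulim_cst.
  have := loeb_op_st (@Linf_cst R _ Om 1) b1 b1 im1 (aeW _ st1).
  by apply: filterS => x ->.
Qed.

Definition ultraproduct : MarkovGraphop R := MkMarkovGraphop loeb_op_markov.

End loeb_operator.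

(** * Euclidean distance, neighbourhoods and Borel sets *)

Section edist.
Context {R : realType} {n : nat}.
Implicit Types x y z : 'I_n -> R.

Lemma edist_ge0 x y : 0 <= edist x y.
Proof. exact: sqrtr_ge0. Qed.

Lemma edistxx x : edist x x = 0.
Proof.
by rewrite /edist big1 ?sqrtr0// => i _; rewrite subrr expr0n.
Qed.

Lemma edistC x y : edist x y = edist y x.
Proof.
by congr Num.sqrt; apply: eq_bigr => i _; rewrite -(sqrrN (x i - y i)) opprB.
Qed.

Lemma cauchy_schwarz_sum (a b : 'I_n -> R) :
  \sum_(i < n) a i * b i <= Num.sqrt (\sum_(i < n) a i ^+ 2) * Num.sqrt (\sum_(i < n) b i ^+ 2).
Proof.
have sq0 (c : 'I_n -> R) : 0 <= \sum_(i < n) c i ^+ 2.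
  by apply: sumr_ge0 => i _; exact: sqr_ge0.
set A := Num.sqrt _; set B := Num.sqrt _.
have A2 : A ^+ 2 = \sum_(i < n) a i ^+ 2 by rewrite sqr_sqrtr.
have B2 : B ^+ 2 = \sum_(i < n) b i ^+ 2 by rewrite sqr_sqrtr.
have A0 : 0 <= A := sqrtr_ge0 _; have B0 : 0 <= B := sqrtr_ge0 _.
have zero (c : 'I_n -> R) i : \sum_(i < n) c i ^+ 2 = 0 -> c i = 0.
  move=> /eqP; rewrite psumr_eq0; last by move=> j _; exact: sqr_ge0.
  by move=> /allP/(_ i (mem_index_enum _)); rewrite sqrf_eq0 => /eqP.
have [AB|AB] := eqVneq (A * B) 0.
  rewrite AB big1// => i _; move/eqP: AB; rewrite mulf_eq0 => /orP[] /eqP e0.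
    by rewrite (zero a) ?mul0r// -A2 e0 expr0n.
  by rewrite (zero b) ?mulr0// -B2 e0 expr0n.
have AB0 : 0 < A * B by rewrite lt0r AB mulr_ge0.
(* This sum of squares expands to $2AB(AB - \sum_i a_i b_i)$, and $AB > 0$ can be divided out. *)
have := sq0 (fun i => B * a i - A * b i).
have -> : \sum_(i < n) (B * a i - A * b i) ^+ 2 =
    B ^+ 2 * (\sum_(i < n) a i ^+ 2) - (2 * (A * B)) * (\sum_(i < n) a i * b i)
    + A ^+ 2 * (\sum_(i < n) b i ^+ 2).
  rewrite !mulr_sumr -sumrN -!big_split/=; apply: eq_bigr => i _; ring.
rewrite -A2 -B2 => h.
have : 0 <= 2 * (A * B) * (A * B - \sum_(i < n) a i * b i) by move: h; lra.
by rewrite pmulr_rge0 ?subr_ge0// mulr_gt0.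
Qed.

Lemma edist_triangle y x z : edist x z <= edist x y + edist y z.
Proof.
have sq0 (c : 'I_n -> R) : 0 <= \sum_(i < n) c i ^+ 2.
  by apply: sumr_ge0 => i _; exact: sqr_ge0.
rewrite -[leRHS]ger0_norm ?addr_ge0 ?edist_ge0// -sqrtr_sqr.
rewrite ler_wsqrtr// sqrrD !sqr_sqrtr//.
have := cauchy_schwarz_sum (fun i => x i - y i) (fun i => y i - z i).
rewrite -/(edist x y) -/(edist y z) => h.
have -> : \sum_(i < n) (x i - z i) ^+ 2 = \sum_(i < n) (x i - y i) ^+ 2 +
    2 * (\sum_(i < n) (x i - y i) * (y i - z i)) + \sum_(i < n) (y i - z i) ^+ 2.
  by rewrite mulr_sumr -!big_split/=; apply: eq_bigr => i _; ring.
by rewrite lerD2r lerD2l -mulr_natl; lra.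
Qed.

Lemma edist_le x y (c : R) : 0 <= c -> (forall i, `|x i - y i| <= c) -> edist x y <= n%:R * c.
Proof.
move=> c0 xy; have [n0|n0] := posnP n.
  rewrite /edist big1 ?sqrtr0 ?mulr_ge0// => -[i ilt]; exfalso.
  by move: ilt; rewrite n0.
rewrite -[leRHS]ger0_norm ?mulr_ge0// -sqrtr_sqr ler_wsqrtr//.
apply: (@le_trans _ _ (\sum_(i < n) c ^+ 2)).
  by apply: ler_sum => i _; rewrite -real_normK ?num_real// lerXn2r ?nnegrE.
rewrite sumr_const card_ord exprMn -[leLHS]mulr_natl ler_wpM2r ?sqr_ge0//.
by rewrite expr2 -natrM ler_nat leq_pmulr.
Qed.

Lemma eopen_eps_nbhd (e : R) (B : set ('I_n -> R)) : eopen (eps_nbhd e B).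
Proof.
move=> x [y By xy]; exists (e - edist x y); first by rewrite subr_gt0.
move=> z xz; exists y => //.
by apply: le_lt_trans (edist_triangle x _ _) _; rewrite (edistC z); lra.
Qed.

Lemma borel_eps_nbhd (e : R) (B : set ('I_n -> R)) : borel (eps_nbhd e B).
Proof. by apply: sub_gen_smallest; exact: eopen_eps_nbhd. Qed.

Lemma eps_nbhd_add (e e' : R) (B : set ('I_n -> R)) :
  eps_nbhd e' (eps_nbhd e B) `<=` eps_nbhd (e + e') B.
Proof.
move=> x [y [z Bz yz] xy]; exists z => //.
by apply: le_lt_trans (edist_triangle y _ _) _; lra.
Qed.

Definition measurable_vec d (T : measurableType d) (X : T -> 'I_n -> R) :=
  forall i, measurable_fun setT (fun t => X t i).

(** An open set is the union of the countably many rational boxes that it contains. *)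
Lemma measurable_preimage_eopen d (T : measurableType d) (X : T -> 'I_n -> R) U :
  measurable_vec X -> eopen U -> measurable (X @^-1` U).
Proof.
move=> mX oU.
pose box (qr : {ffun 'I_n -> rat} * rat) : set ('I_n -> R) :=
  [set y | forall i, `|y i - ratr (qr.1 i)| < ratr qr.2].
have -> : X @^-1` U = \bigcup_qr
    (if `[< box qr `<=` U >] then X @^-1` (box qr) else set0).
  apply/seteqP; split=> [t Ut|t [qr _]]; last first.
    by case: asboolP => // sub /sub.
  have [e e0 He] := oU _ Ut.
  (* Two points of a box of radius $r$ differ by less than $2r$ in each coordinate, so their
     distance is at most $2nr$; [n.+1] covers [n = 0]. *)
  have e'0 : 0 < e / (n.+1 * 2)%:R by rewrite divr_gt0// ltr0n.
  have [r] := rat_in_itvoo e'0; rewrite in_itv/= => /andP[r0 re].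
  have qP i : exists q, `|X t i - ratr q| < ratr r.
    have [q] : exists q, ratr q \in `]X t i - ratr r, X t i + ratr r[.
      by apply: rat_in_itvoo; lra.
    rewrite in_itv/= => /andP[h1 h2]; exists q; rewrite ltr_norml.
    by apply/andP; split; lra.
  pose q := [ffun i => projT1 (cid (qP i))].
  have qP' i : `|X t i - ratr (q i)| < ratr r by rewrite ffunE; exact: projT2 (cid (qP i)).
  exists (q, r) => //; rewrite asboolT// => y /= hy; apply: He.
  apply: (@le_lt_trans _ _ (n%:R * (2 * ratr r))).
    apply: edist_le => [|i]; first by rewrite mulr_ge0// ltW.
    rewrite (_ : _ - _ = (X t i - ratr (q i)) - (y i - ratr (q i))); last by ring.
    apply: (le_trans (ler_normB _ _)).
    by have := qP' i; have := hy i; lra.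
  move: re; rewrite ltr_pdivlMr ?ltr0n// natrM -natr1 => re.
  by rewrite mulrA (mulrC _ (ratr r)); move: re r0; lra.
apply: countable_bigcupT_measurable; first exact: countableP.
move=> qr; case: asboolP => _; last exact: measurable0.
have -> : X @^-1` box qr =
    \bigcap_(i in [set: 'I_n]) [set t | `|X t i - ratr (qr.1 i)| < ratr qr.2].
  by apply/seteqP; split=> t /= h; [move=> i _|move=> i]; exact: h.
apply: fin_bigcap_measurable => // i _.
have mf : measurable_fun setT (fun t => `|X t i - ratr (qr.1 i)|).
  by apply: measurableT_comp => //; apply: measurable_funB.
have := mf measurableT `]-oo, ratr qr.2[%classic (measurable_itv _).
by rewrite setTI; congr measurable; apply/seteqP; split=> t /=; rewrite in_itv.
Qed.

Lemma measurable_preimage_borel d (T : measurableType d) (X : T -> 'I_n -> R) B :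
  measurable_vec X -> borel B -> measurable (X @^-1` B).
Proof.
move=> mX; apply: (@smallest_sub _ _ _ [set B | measurable (X @^-1` B)]).
  split=> [|A mA|F mF]; rewrite /=.
  - by rewrite preimage_set0.
  - by rewrite setTD preimage_setC; exact: measurableC.
  - by rewrite preimage_bigcup; exact: bigcupT_measurable.
by move=> U oU; exact: measurable_preimage_eopen.
Qed.

Lemma measurable_preimage_eps d (T : measurableType d) (X : T -> 'I_n -> R) e B :
  measurable_vec X -> measurable (X @^-1` eps_nbhd e B).
Proof. by move=> mX; apply: measurable_preimage_borel => //; exact: borel_eps_nbhd. Qed.

End edist.

(** * The Levy-Prokhorov distance, and an estimate by finite partitions *)

Section dLP_theory.
Context {R : realType} {n : nat}.
Implicit Types B : set ('I_n -> R).

Definition LP_close d1 (T1 : measurableType d1) (P1 : probability T1 R) (X : T1 -> 'I_n -> R)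
    d2 (T2 : measurableType d2) (P2 : probability T2 R) (Y : T2 -> 'I_n -> R) (e : R) :=
  forall B, borel B -> pr P1 (X @^-1` B) <= pr P2 (Y @^-1` eps_nbhd e B) + e.

Section two.
Context {d1} {T1 : measurableType d1} (P1 : probability T1 R) (X : T1 -> 'I_n -> R).
Context {d2} {T2 : measurableType d2} (P2 : probability T2 R) (Y : T2 -> 'I_n -> R).
Hypotheses (mX : measurable_vec X) (mY : measurable_vec Y).

Let S := [set e : R | 0 < e /\ forall B, borel B ->
     (P1 (X @^-1` B) <= P2 (Y @^-1` eps_nbhd e B) + e%:E)%E /\
     (P2 (Y @^-1` B) <= P1 (X @^-1` eps_nbhd e B) + e%:E)%E].

Let SE e : S e <-> [/\ 0 < e, LP_close P1 X P2 Y e & LP_close P2 Y P1 X e].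
Proof.
have h1 B : borel B -> (P1 (X @^-1` B) <= P2 (Y @^-1` eps_nbhd e B) + e%:E)%E <->
   pr P1 (X @^-1` B) <= pr P2 (Y @^-1` eps_nbhd e B) + e.
  move=> bB; rewrite !pr_fin ?lee_fin//;
    first [exact: measurable_preimage_borel|exact: measurable_preimage_eps].
have h2 B : borel B -> (P2 (Y @^-1` B) <= P1 (X @^-1` eps_nbhd e B) + e%:E)%E <->
   pr P2 (Y @^-1` B) <= pr P1 (X @^-1` eps_nbhd e B) + e.
  move=> bB; rewrite !pr_fin ?lee_fin//;
    first [exact: measurable_preimage_borel|exact: measurable_preimage_eps].
split=> [[e0 H]|[e0 H1 H2]].
  by split=> // B bB; have [H1 H2] := H B bB; [exact/h1|exact/h2].
by split=> // B bB; split; [apply/h1 => //; exact: H1|apply/h2 => //; exact: H2].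
Qed.

Let S1 : S 1.
Proof.
apply/SE; split=> // B bB; rewrite (le_trans (pr_le1 _ _))// ?lerDr ?pr_ge0//;
  exact: measurable_preimage_borel.
Qed.

Let S0 : lbound S 0.
Proof. by move=> e [/ltW]. Qed.

Lemma dLP_ge0 : 0 <= dLP P1 X P2 Y.
Proof. by apply: lb_le_inf; [exists 1|exact: S0]. Qed.

Lemma dLP_le e : 0 < e -> LP_close P1 X P2 Y e -> LP_close P2 Y P1 X e ->
  dLP P1 X P2 Y <= e.
Proof. by move=> e0 h1 h2; apply: ge_inf; [exists 0|exact/SE]. Qed.

Lemma dLP_le1 : dLP P1 X P2 Y <= 1.
Proof. by apply: ge_inf; [exists 0|]. Qed.

Lemma dLP_lt c : dLP P1 X P2 Y < c -> exists e,
  [/\ 0 < e, e < c, LP_close P1 X P2 Y e & LP_close P2 Y P1 X e].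
Proof.
rewrite -subr_gt0 => c0.
have [|e /SE[e0 h1 h2] ec] := @inf_adherent R S _ c0; first by split; [exists 1|exists 0].
by exists e; split=> //; rewrite (lt_le_trans ec)// addrC subrK.
Qed.

End two.

Lemma dLPC d1 (T1 : measurableType d1) (P1 : probability T1 R) (X : T1 -> 'I_n -> R)
    d2 (T2 : measurableType d2) (P2 : probability T2 R) (Y : T2 -> 'I_n -> R) :
  dLP P1 X P2 Y = dLP P2 Y P1 X.
Proof.
congr inf; apply/seteqP; split=> e [e0 H]; split=> // B /H[]; by split.
Qed.

Lemma dLPxx d1 (T1 : measurableType d1) (P1 : probability T1 R) (X : T1 -> 'I_n -> R) :
  measurable_vec X -> dLP P1 X P1 X = 0.
Proof.
move=> mX; apply/eqP; rewrite eq_le dLP_ge0// andbT; apply/ler_addgt0Pr => e e0.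
have H : LP_close P1 X P1 X e.
  move=> B bB; suff : pr P1 (X @^-1` B) <= pr P1 (X @^-1` eps_nbhd e B) by lra.
  apply: pr_mono.
  - exact: measurable_preimage_borel.
  - exact: measurable_preimage_eps.
  - by move=> t Bt; exists (X t) => //; rewrite edistxx.
by rewrite add0r dLP_le.
Qed.

Lemma LP_close_trans d1 (T1 : measurableType d1) (P1 : probability T1 R) (X : T1 -> 'I_n -> R)
    d2 (T2 : measurableType d2) (P2 : probability T2 R) (Y : T2 -> 'I_n -> R)
    d3 (T3 : measurableType d3) (P3 : probability T3 R) (Z : T3 -> 'I_n -> R) e e' :
  measurable_vec Z ->
  LP_close P1 X P2 Y e -> LP_close P2 Y P3 Z e' -> LP_close P1 X P3 Z (e + e').
Proof.
move=> mZ h1 h2 B bB; have := h1 B bB; have := h2 _ (borel_eps_nbhd e B).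
have : pr P3 (Z @^-1` eps_nbhd e' (eps_nbhd e B)) <= pr P3 (Z @^-1` eps_nbhd (e + e') B).
  apply: pr_mono.
  - exact: measurable_preimage_eps.
  - exact: measurable_preimage_eps.
  - by move=> t; exact: eps_nbhd_add.
lra.
Qed.

Lemma dLP_triangle d1 (T1 : measurableType d1) (P1 : probability T1 R) (X : T1 -> 'I_n -> R)
    d2 (T2 : measurableType d2) (P2 : probability T2 R) (Y : T2 -> 'I_n -> R)
    d3 (T3 : measurableType d3) (P3 : probability T3 R) (Z : T3 -> 'I_n -> R) :
  measurable_vec X -> measurable_vec Y -> measurable_vec Z ->
  dLP P1 X P3 Z <= dLP P1 X P2 Y + dLP P2 Y P3 Z.
Proof.
move=> mX mY mZ; apply/ler_addgt0Pr => e e0; have e2 : 0 < e / 2 by rewrite divr_gt0.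
have [|a [a0 ae h1 h2]] := @dLP_lt _ _ P1 X _ _ P2 Y mX mY (dLP P1 X P2 Y + e / 2).
  by rewrite ltrDl.
have [|b [b0 be h3 h4]] := @dLP_lt _ _ P2 Y _ _ P3 Z mY mZ (dLP P2 Y P3 Z + e / 2).
  by rewrite ltrDl.
apply: (@le_trans _ _ (a + b)); last by lra.
apply: dLP_le => //; [exact: addr_gt0|exact: LP_close_trans h1 h3|].
by rewrite addrC; exact: LP_close_trans h4 h2.
Qed.

Lemma pr_cells d (T : measurableType d) (Q : probability T R) (C : finType) (a : T -> C)
    (p : pred C) : (forall c, measurable (a @^-1` [set c])) ->
  measurable [set t | p (a t)] /\ pr Q [set t | p (a t)] = \sum_(c | p c) pr Q (a @^-1` [set c]).
Proof.
move=> ma; rewrite -big_filter -/(enum p); have := enum_uniq p.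
have -> : [set t | p (a t)] = [set t | a t \in enum p].
  by apply/seteqP; split=> t /=; rewrite mem_enum.
elim: (enum p) => [_|c s IH /= /andP[cs /IH[ms IHs]]].
  have -> : [set t | a t \in [::]] = set0 by apply/seteqP; split.
  by rewrite big_nil /pr measure0.
have -> : [set t | a t \in c :: s] = a @^-1` [set c] `|` [set t | a t \in s].
  apply/seteqP; split=> t /=; rewrite inE.
    by move=> /predU1P[]; [left|right].
  by move=> [->|->]; rewrite ?eqxx ?orbT.
split; first exact: measurableU.
rewrite big_cons prU ?IHs//.
by apply/seteqP; split=> // t /= [-> ]; rewrite (negbTE cs).
Qed.

Lemma LP_close_cells d1 (T1 : measurableType d1) (P1 : probability T1 R) (X : T1 -> 'I_n -> R)
    d2 (T2 : measurableType d2) (P2 : probability T2 R) (Y : T2 -> 'I_n -> R)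
    (C : finType) (a : T1 -> C) (b : T2 -> C) (p : T1 -> Prop) (q : T2 -> Prop) e :
  measurable_vec X -> measurable_vec Y ->
  (forall c, measurable (a @^-1` [set c])) -> (forall c, measurable (b @^-1` [set c])) ->
  {ae P1, forall x, p x} -> {ae P2, forall y, q y} ->
  (forall x y, p x -> q y -> a x = b y -> edist (X x) (Y y) < e) ->
  \sum_c `|pr P1 (a @^-1` [set c]) - pr P2 (b @^-1` [set c])| <= e ->
  LP_close P1 X P2 Y e.
Proof.
move=> mX mY ma mb [N1 [mN1 N10 pN1]] [N2 [mN2 N20 qN2]] abe sume B bB.
have prN1 : pr P1 N1 = 0 by rewrite /pr N10.
have prN2 : pr P2 N2 = 0 by rewrite /pr N20.
pose s c := `[< exists x, [/\ a x = c, p x & B (X x)] >].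
have [mas as_] := pr_cells P1 s ma; have [mbs bs] := pr_cells P2 s mb.
have mXB := measurable_preimage_borel mX bB.
have mYB := measurable_preimage_eps e B mY.
have h1 : pr P1 (X @^-1` B) <= pr P1 [set t | s (a t)] + pr P1 N1.
  apply: le_trans (prU_le _ mas mN1); apply: pr_mono => //; first exact: measurableU.
  move=> x Bx; have [px|npx] := pselect (p x); [left|by right; exact: pN1].
  by apply/asboolP; exists x.
have h2 : pr P2 [set t | s (b t)] <= pr P2 (Y @^-1` eps_nbhd e B) + pr P2 N2.
  apply: le_trans (prU_le _ mYB mN2); apply: pr_mono => //; first exact: measurableU.
  move=> y /asboolP[x [axb px Bx]].
  have [qy|nqy] := pselect (q y); [left|by right; exact: qN2].
  by exists (X x) => //; rewrite edistC; exact: abe.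
have h3 : pr P1 [set t | s (a t)] <= pr P2 [set t | s (b t)] + e.
  rewrite as_ bs -lerBlDl; apply: le_trans sume.
  rewrite -sumrB [leRHS](bigID s)/=; rewrite -[leLHS]addr0 lerD ?sumr_ge0//.
  by apply: ler_sum => c _; exact: ler_norm.
move: h1 h2 h3; rewrite prN1 prN2; lra.
Qed.

Lemma dLP_cells d1 (T1 : measurableType d1) (P1 : probability T1 R) (X : T1 -> 'I_n -> R)
    d2 (T2 : measurableType d2) (P2 : probability T2 R) (Y : T2 -> 'I_n -> R)
    (C : finType) (a : T1 -> C) (b : T2 -> C) (p : T1 -> Prop) (q : T2 -> Prop) e :
  0 < e -> measurable_vec X -> measurable_vec Y ->
  (forall c, measurable (a @^-1` [set c])) -> (forall c, measurable (b @^-1` [set c])) ->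
  {ae P1, forall x, p x} -> {ae P2, forall y, q y} ->
  (forall x y, p x -> q y -> a x = b y -> edist (X x) (Y y) < e) ->
  \sum_c `|pr P1 (a @^-1` [set c]) - pr P2 (b @^-1` [set c])| <= e ->
  dLP P1 X P2 Y <= e.
Proof.
move=> e0 mX mY ma mb pP qP abe sume; apply: dLP_le => //.
  exact: LP_close_cells pP qP abe sume.
apply: (LP_close_cells mY mX mb ma qP pP) => [y x qy px ba|].
  by rewrite edistC; exact: abe.
by under eq_bigr do rewrite distrC.
Qed.

End dLP_theory.

(** * The pseudometric [dM] *)

Section dM_theory.
Context {R : realType}.
Implicit Types G H K : MarkovGraphop R.

Definition profile_dist k G (v : 'I_k -> mg_T G -> R) H (w : 'I_k -> mg_T H -> R) : R :=
  dLP (mg_P G) (profile_vec (@mg_A R G) v) (mg_P H) (profile_vec (@mg_A R H) w).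

Arguments profile_dist {k} G v H w.

Lemma test_family_Linf k G (v : 'I_k -> mg_T G -> R) i : test_family v -> Linf (v i).
Proof.
move=> tv; have [mv v1] := tv i; apply: (@Linf_le _ _ _ _ 1) => // x.
by rewrite ler_norml.
Qed.

Lemma test_family0 k G : test_family (fun (_ : 'I_k) (_ : mg_T G) => 0 : R).
Proof. by move=> i; split=> // x; apply/andP; split; lra. Qed.

Lemma measurable_profile k G (v : 'I_k -> mg_T G -> R) : test_family v ->
  measurable_vec (profile_vec (@mg_A R G) v).
Proof.
move=> tv j; rewrite /profile_vec; case: (fintype.split j) => i; first by case: (tv i).
exact: (markov_measurable (mg_markov G) (test_family_Linf i tv)).
Qed.

Section half.
Context (k : nat) (G H : MarkovGraphop R).
Local Notation infs v := (inf [set profile_dist G v H w | w in @test_family R k _ (mg_T H)]).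

Let infs_le (v : 'I_k -> mg_T G -> R) w : test_family v -> test_family w ->
  infs v <= profile_dist G v H w.
Proof.
move=> tv tw; apply: ge_inf; last by exists w.
by exists 0 => _ [w' tw' <-]; apply: dLP_ge0; exact: measurable_profile.
Qed.

Let infs_adherent (v : 'I_k -> mg_T G -> R) e : test_family v -> 0 < e ->
  exists2 w : 'I_k -> mg_T H -> R, test_family w & profile_dist G v H w < infs v + e.
Proof.
move=> tv e0; have [|_ [w tw <-] wlt] := @inf_adherent R
    [set profile_dist G v H w | w in @test_family R k _ (mg_T H)] _ e0; last by exists w.
split.
  by exists (profile_dist G v H (fun _ _ => 0)), (fun _ _ => 0) => //; exact: test_family0.
by exists 0 => _ [w' tw' <-]; apply: dLP_ge0; exact: measurable_profile.
Qed.

Let has_sup_infs : has_sup [set infs (v : 'I_k -> mg_T G -> R) | v in @test_family R k _ (mg_T G)].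
Proof.
split; first by exists (infs (fun _ _ => 0)), (fun _ _ => 0) => //; exact: test_family0.
exists 1 => _ [v tv <-]; have t0 := @test_family0 k H.
apply: le_trans (infs_le tv t0) _; apply: dLP_le1; exact: measurable_profile.
Qed.

(** Together with [dH_half_le], the interface to the sup-inf formula. The zero family and the bounds
    0 and 1 on [dLP] ensure that these real suprema and infima are genuine. *)
Lemma dH_half_approx (v : 'I_k -> mg_T G -> R) e : test_family v -> 0 < e ->
  exists2 w : 'I_k -> mg_T H -> R, test_family w & profile_dist G v H w < dH_half k G H + e.
Proof.
move=> tv e0; have [w tw wlt] := infs_adherent tv e0; exists w => //.
apply: lt_le_trans wlt _; rewrite lerD2r; apply: ub_le_sup; first by case: has_sup_infs.
by exists v.
Qed.

Lemma dH_half_le c : (forall (v : 'I_k -> mg_T G -> R) e, test_family v -> 0 < e ->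
    exists2 w : 'I_k -> mg_T H -> R, test_family w & profile_dist G v H w <= c + e) ->
  dH_half k G H <= c.
Proof.
move=> h; apply: ge_sup; first by case: has_sup_infs.
move=> _ [v tv <-]; apply/ler_addgt0Pr => e e0.
by have [w tw] := h v e tv e0; apply: le_trans; exact: infs_le.
Qed.

Lemma dH_half_ge0 : 0 <= dH_half k G H.
Proof.
apply/ler_addgt0Pr => e e0; have t0 := @test_family0 k G.
have [w tw /ltW] := dH_half_approx t0 e0; apply: le_trans.
by apply: dLP_ge0; exact: measurable_profile.
Qed.

Lemma dH_half_le1 : dH_half k G H <= 1.
Proof.
apply: dH_half_le => v e tv e0; exists (fun _ _ => 0); first exact: test_family0.
have t0 := @test_family0 k H.
apply: (@le_trans _ _ 1); last by lra.
by apply: dLP_le1; exact: measurable_profile.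
Qed.

End half.

Lemma dH_half_xx k G : dH_half k G G = 0.
Proof.
apply/eqP; rewrite eq_le dH_half_ge0 andbT; apply: dH_half_le => v e tv e0.
by exists v => //; rewrite /profile_dist dLPxx ?add0r ?ltW//; exact: measurable_profile.
Qed.

Lemma dH_half_triangle k G H K : dH_half k G K <= dH_half k G H + dH_half k H K.
Proof.
apply: dH_half_le => v e tv e0; have e2 : 0 < e / 2 by rewrite divr_gt0.
have [w tw vw] := dH_half_approx H tv e2; have [u tu wu] := dH_half_approx K tw e2.
exists u => //; apply: (@le_trans _ _ (profile_dist G v H w + profile_dist H w K u)); last by lra.
by apply: dLP_triangle; exact: measurable_profile.
Qed.

Lemma dH_ge0 k G H : 0 <= dH k G H.
Proof. by rewrite le_max dH_half_ge0. Qed.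

Lemma dH_le1 k G H : dH k G H <= 1.
Proof. by rewrite ge_max !dH_half_le1. Qed.

Lemma dHC k G H : dH k G H = dH k H G.
Proof. exact: maxC. Qed.

Lemma dH_triangle k G H K : dH k G K <= dH k G H + dH k H K.
Proof.
have le1 : dH_half k G H <= dH k G H by rewrite le_max lexx.
have le2 : dH_half k H K <= dH k H K by rewrite le_max lexx.
have le3 : dH_half k K H <= dH k H K by rewrite le_max lexx orbT.
have le4 : dH_half k H G <= dH k G H by rewrite le_max lexx orbT.
have := dH_half_triangle k G H K; have := dH_half_triangle k K H G.
by rewrite ge_max => h1 h2; apply/andP; split; lra.
Qed.

Definition dM_term G H (k : nat) : R := 2%:R ^- k.+1 * dH k.+1 G H.

Definition dM_partial G H (N : nat) : R := \sum_(0 <= k < N) dM_term G H k.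

Lemma dM_term_ge0 G H k : 0 <= dM_term G H k.
Proof. by rewrite mulr_ge0 ?dH_ge0// invr_ge0 exprn_ge0. Qed.

Lemma dM_series_mono G H N m : (N <= m)%N ->
  dM_partial G H N <= dM_partial G H m.
Proof.
move=> /subnKC <-; elim: (m - N)%N => [|j IH]; first by rewrite addn0.
rewrite addnS /dM_partial big_nat_recr//=; apply: (le_trans IH).
by rewrite lerDl dM_term_ge0.
Qed.

Lemma dM_series_tail G H N m : (N <= m)%N ->
  dM_partial G H m <= dM_partial G H N + 2^-1 ^+ N.
Proof.
move=> /subnKC <-; set j := (m - N)%N.
suff : dM_partial G H (N + j) <= dM_partial G H N + (2^-1 ^+ N - 2^-1 ^+ (N + j)).
  by move/le_trans; apply; rewrite lerD2l lerBlDr lerDl exprn_ge0// invr_ge0.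
elim: j => [|j IH]; first by rewrite addn0 subrr addr0.
rewrite addnS /dM_partial big_nat_recr//=.
have : dM_term G H (N + j) <= 2^-1 ^+ (N + j).+1.
  by rewrite /dM_term -exprVn ler_piMr ?dH_le1// exprn_ge0// invr_ge0.
by move: IH; rewrite /dM_partial exprS; set a := _ ^+ (N + j); lra.
Qed.

Lemma cvg_dM G H : dM_partial G H @ \oo --> dM G H.
Proof.
apply: nondecreasing_is_cvgn; first by move=> N m; exact: dM_series_mono.
exists 1 => _ [m _ <-].
have := dM_series_tail G H (leq0n m).
by rewrite {2}/dM_partial big_geq// add0r expr0.
Qed.

(** Since [dH] is at most 1 the tail is geometric, so finitely many profiles control [dM]. *)
Lemma dM_le_series G H N : dM G H <= dM_partial G H N + 2^-1 ^+ N.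
Proof.
apply: (ler_cvg_to (@cvg_dM G H) (cvg_cst _)).
by exists N => // m /=; exact: dM_series_tail.
Qed.

Lemma dMxx G : dM G G = 0.
Proof.
apply: (cvg_unique _ (@cvg_dM G G)) => //.
rewrite (_ : dM_partial G G = fun=> 0); first exact: cvg_cst.
apply/funext => m; rewrite /dM_partial big1// => k _.
by rewrite /dM_term /dH dH_half_xx maxxx mulr0.
Qed.

Lemma dM_ge0 G H : 0 <= dM G H.
Proof.
apply: ler_cvg_to (cvg_cst 0) (@cvg_dM G H) _.
by apply: nearW => m; rewrite /dM_partial sumr_ge0// => k _; exact: dM_term_ge0.
Qed.

Lemma dMC G H : dM G H = dM H G.
Proof.
by rewrite /dM; congr (limn (series _)); apply/funext => k; rewrite dHC.
Qed.

Lemma dM_triangle G H K : dM G K <= dM G H + dM H K.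
Proof.
have le m : dM_partial G K m <= dM_partial G H m + dM_partial H K m.
  rewrite /dM_partial -big_split/=; apply: ler_sum => k _.
  by rewrite /dM_term -mulrDr ler_wpM2l ?dH_triangle// invr_ge0 exprn_ge0.
apply: ler_cvg_to (@cvg_dM G K) (cvgD (@cvg_dM G H) (@cvg_dM H K)) _.
by apply: nearW => m; exact: le.
Qed.

End dM_theory.

Arguments profile_dist {R k} G v H w.

(** Points with the same first [J] digits differ by at most $2 \cdot 2^{-J}$ in each of [m]
    coordinates; this is the resulting bound from [edist_le]. *)
Lemma mesh_small {R : realType} (m : nat) (e : R) : 0 < e ->
  exists J, m%:R * (2 * 2^-1 ^+ J) < e.
Proof.
move=> e0; have e'0 : 0 < e / (m.+1 * 2)%:R by rewrite divr_gt0// ltr0n.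
have [J HJ] := half_expn_small e'0; exists J.
have a0 : 0 < 2^-1 ^+ J :> R by rewrite exprn_gt0// invr_gt0.
by move: HJ; rewrite ler_pdivlMr ?ltr0n// natrM -natr1; set a := _ ^+ J in a0 *; lra.
Qed.

Lemma cell_close {R : realType} (s t z c : R) : `|s - z| <= c -> `|t - z| <= c -> `|s - t| <= 2 * c.
Proof.
rewrite !ler_norml => /andP[? ?] /andP[? ?]; apply/andP; split; lra.
Qed.

Lemma measurable_code d (T : measurableType d) (I : finType) (p : I -> set T)
    (c : {ffun I -> bool}) :
  (forall i, measurable (p i)) ->
  measurable ((fun t => [ffun i => `[<p i t>]]) @^-1` [set c]).
Proof.
move=> mp; rewrite (_ : _ @^-1` _ =
    \bigcap_(i in [set: I]) [set t | `[<p i t>] = c i]).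
  apply: fin_bigcap_measurable => // i _; case: (c i).
    by rewrite (_ : [set t | _] = p i)//; apply/seteqP; split=> t /asboolP.
  rewrite (_ : [set t | _] = ~` p i); first exact: measurableC.
  by apply/seteqP; split=> t /=; [move=> h /asboolP; rewrite h|exact: asboolF].
apply/seteqP; split=> t /=; first by move=> <- i _; rewrite ffunE.
by move=> h; apply/ffunP => i; rewrite ffunE; exact: h.
Qed.

(** * Laws of standard parts are ultralimits of laws *)

Section loeb_convergence.
Context {R : realType} (d : nat -> measure_display)
  (T : forall n, measurableType (d n)) (P : forall n, probability (T n) R).
Local Notation mu := (@loebP _ _ _ P : probability (loeb P) R).

Lemma near_dLP_st m (X : loeb P -> 'I_m -> R) (Y : forall n, T n -> 'I_m -> R)
    (g : 'I_m -> forall n, T n -> R) (e : R) :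
  0 < e -> measurable_vec X -> (forall n, measurable_vec (Y n)) ->
  (forall i, ibounded 1 (g i)) ->
  {ae mu, forall x, forall i, X x i = st (g i) x} ->
  (forall n, {ae P n, forall y, forall i, Y n y i = g i n y}) ->
  ultra [set n | dLP mu X (P n) (Y n) <= e].
Proof.
move=> e0 mX mY g1 Xg Yg; have [J HJ] := mesh_small m e0.
pose C := {ffun 'I_m * 'I_J -> bool}.
pose a (x : loeb P) : C := [ffun ij : 'I_m * 'I_J => `[<hull (P := P) (dset (g ij.1) ij.2) x>]].
pose b n (y : T n) : C := [ffun ij : 'I_m * 'I_J => `[<dset (g ij.1) ij.2 n y>]].
pose cell c n := b n @^-1` [set c].
have bE n y ij : b n y ij = digit ij.2 (g ij.1 n y).
  by rewrite ffunE; apply/asboolP/idP.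
have iD (ij : 'I_m * 'I_J) : internal (dset (g ij.1) ij.2) := internal_dset ij.2 (g1 ij.1).
have ic c : internal (cell c).
  by move=> n; apply: measurable_code => ij; exact: iD.
(* Only finitely many bits occur, so along [ultra] the code of [x n] is that of [x]. Hence the cells
   of [a] are the hulls of the cells of [b], and their weights converge. *)
have UD (x : loeb P) : ultra [set n | b n (x n) = a x].
  have : ultra [set n | forall ij, b n (x n) ij = a x ij].
    apply: filter_forall => ij; rewrite [a x ij]ffunE; case: asboolP => [h|/hullC h].
      by apply: filterS h => n h; rewrite bE.
    by apply: filterS h => n h; rewrite bE; apply/negP.
  by apply: filterS => n h; apply/ffunP.
have aE c : a @^-1` [set c] = hull (P := P) (cell c).
  apply/seteqP; split=> x /= h; first by apply: filterS (UD x) => n bn; rewrite /cell /= bn.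
  by have [n [/= <- <-]] := filter_ex (filterI (UD x) h).
have ma c : measurable (a @^-1` [set c]) by rewrite aE; exact: measurable_hull.
have cS : (fun n => \sum_c `|pr mu (a @^-1` [set c]) - pr (P n) (cell c n)|) @ ultra -->
    (\sum_(c : C) 0 : R).
  apply: cvg_bigsum => c; rewrite -(normr0 R) -(subrr (pr mu (a @^-1` [set c]))).
  apply: cvg_norm; apply: cvgB; first exact: cvg_cst.
  by rewrite aE pr_hull//; exact: cvg_wP.
rewrite big1// in cS.
apply: filterS (near_ulimB e0 cS) => n /=; rewrite subr0 ger0_norm ?sumr_ge0// => sume.
apply: (dLP_cells e0 mX (mY n) ma (fun c => ic c n) Xg (Yg n) _ sume) => x y hx hy ab.
apply: le_lt_trans HJ; apply: edist_le => [|i].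
  by rewrite mulr_ge0// exprn_ge0// invr_ge0.
rewrite hx hy; apply: (@cell_close _ _ _ (dsum J (digit^~ (g i n y)))).
  rewrite -(dsum_eq (b := fun j => `[<hull (P := P) (dset (g i) j) x>])).
    exact: st_dsum.
  by move=> j; have := congr1 (fun c : C => c (i, j)) ab; rewrite /= bE ffunE.
by apply: dsum_digit; exact: (g1 i).2.
Qed.

End loeb_convergence.

(** * Convergence of profiles to those of the ultraproduct *)

Section ultraproduct_limit.
Context {R : realType} (G : nat -> MarkovGraphop R).
Local Notation W := (ultraproduct G).
Local Notation P := (fun n => mg_P (G n)).
Local Notation Om := (loeb P).
Local Notation mu := (@loebP _ _ _ P : probability (loeb P) R).

Lemma near_profile_dist k (v : 'I_k -> mg_T W -> R) (f : 'I_k -> forall n, mg_T (G n) -> R) e :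
  0 < e -> test_family v -> (forall i, ibounded 1 (f i)) ->
  (forall i, {ae mu, forall x, st (f i) x = v i x}) ->
  ultra [set n | profile_dist W v (G n) (fun i => f i n) <= e].
Proof.
move=> e0 tv f1 fv; pose H i := cid2 (image_exists (f1 i)).
pose h i := projT1 (H i).
have h1 i : ibounded 1 (h i) by rewrite /h; case: (H i).
have fh i : image_family (f i) (h i) by rewrite /h; case: (H i).
pose g (j : 'I_(k + k)) := match fintype.split j with inl i => f i | inr i => h i end.
have tf n : test_family (fun i => f i n).
  by move=> i; split=> [|y]; [exact: (f1 i).1|rewrite -ler_norml; exact: (f1 i).2].
apply: (@near_dLP_st _ _ _ P _ _ (fun n => profile_vec (@mg_A R (G n)) (fun i => f i n)) g) => //.
- exact: (@measurable_profile R k W v tv).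
- by move=> n; exact: (measurable_profile (tf n)).
- by move=> j; rewrite /g; case: (fintype.split j).
- have : {ae mu, forall x, forall i : 'I_k, st (f i) x = v i x /\ loeb_op (v i) x = st (h i) x}.
    apply: filter_forall => i.
    have := loeb_op_st (test_family_Linf i tv) (f1 i) (h1 i) (fh i) (fv i).
    by apply: filterS2 (fv i) => x.
  apply: filterS => x hx j; rewrite /profile_vec /g.
  by case: (fintype.split j) => i; have [e1 e2] := hx i; [exact: esym e1|exact: e2].
- move=> n; have : {ae mg_P (G n), forall y, forall i : 'I_k, h i n y = @mg_A R (G n) (f i n) y}.
    by apply: filter_forall => i; exact: fh.
  apply: filterS => y hy j; rewrite /profile_vec /g.
  by case: (fintype.split j) => i //; rewrite hy.
Qed.

(** The family exists unconditionally, and only its badness is conditional, so that one can be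
    chosen for every [n] at once. *)
Lemma profile_bad k (H K : MarkovGraphop R) e : exists2 v : 'I_k -> mg_T H -> R,
  test_family v & ~ (dH_half k H K <= e) ->
    forall w : 'I_k -> mg_T K -> R, test_family w -> e < profile_dist H v K w.
Proof.
have [le|nle] := pselect (dH_half k H K <= e).
  by exists (fun _ _ => 0); [exact: test_family0|].
apply: contrapT => /forall2NP nex; apply: nle; apply: dH_half_le => v e' tv e'0.
have [//|/not_implyP[_ /existsNP[w /not_implyP[tw /negP]]]] := nex v.
by rewrite -leNgt => vw; exists w => //; lra.
Qed.

(** Bad families on the [G n] form an internal family. Its standard part is a test family on [W]
    close to them for almost all [n], a contradiction. *)
Lemma near_dH_half_to k e : 0 < e -> ultra [set n | dH_half k (G n) W <= e].
Proof.
move=> e0; apply: contrapT => /ultraNP bad.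
pose V n := cid2 (profile_bad k (G n) W e).
pose v n := projT1 (V n).
have tv n : test_family (v n) by rewrite /v; case: (V n).
have bv n : ~ (dH_half k (G n) W <= e) -> forall w : 'I_k -> mg_T W -> R, test_family w ->
    e < profile_dist (G n) (v n) W w by rewrite /v; case: (V n).
pose f i n := v n i.
have f1 i : ibounded 1 (f i).
  split=> [n|n y]; have [mv v1] := tv n i; first exact: mv.
  by rewrite /f ler_norml; exact: v1.
have tw : @test_family R k _ (mg_T W) (fun i => st (f i)).
  move=> i; split; first by case: (Linf_st P (f1 i)).
  by move=> x; rewrite -ler_norml; exact: st_bound (f1 i).
have := near_profile_dist e0 tw f1 (fun i => aeW _ (fun x => erefl _)).
move=> /(filterI bad) /filter_ex[n [/= nle]].
rewrite /profile_dist dLPC => le.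
by have := bv n nle _ tw; rewrite ltNge /profile_dist le.
Qed.

(** The bad families [v n] all live on [W] and vary with [n], while [near_profile_dist] needs a
    fixed one. Their vectors of cell weights converge along [ultra], so one [v n0] can replace [v n]
    for almost all [n] at cost [e / 2]; lifting [v n0] costs another [e / 2]. *)
Lemma near_dH_half_from k e : 0 < e -> ultra [set n | dH_half k W (G n) <= e].
Proof.
move=> e0; apply: contrapT => /ultraNP bad; have e2 : 0 < e / 2 by rewrite divr_gt0.
have e4 : 0 < e / 4 by rewrite divr_gt0.
pose V n := cid2 (profile_bad k W (G n) e).
pose v n := projT1 (V n).
have tv n : test_family (v n) by rewrite /v; case: (V n).
have bv n : ~ (dH_half k W (G n) <= e) -> forall w : 'I_k -> mg_T (G n) -> R, test_family w ->
    e < profile_dist W (v n) (G n) w by rewrite /v; case: (V n).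
pose X n := profile_vec (@mg_A R W) (v n).
have mX n : measurable_vec (X n) by exact: measurable_profile.
have X1 n : {ae mg_P W, forall x, forall j, `|X n x j| <= 1}.
  apply: filter_forall => j; rewrite /X /profile_vec; case: (fintype.split j) => i.
    by apply: aeW => x; rewrite ler_norml; exact: (tv n i).2.
  have := @markov_contraction _ _ _ _ _ (mg_markov W) _ 1 (test_family_Linf i (tv n)).
  apply=> x.
  by rewrite ler_norml; exact: (tv n i).2.
have [J HJ] := mesh_small (k + k) e2.
pose C := {ffun 'I_(k + k) * 'I_J -> bool}.
pose a n (x : mg_T W) : C :=
  [ffun ij : 'I_(k + k) * 'I_J => `[<[set x | digit ij.2 (X n x ij.1)] x>]].
have ma n c : measurable (a n @^-1` [set c]).
  by apply: measurable_code => ij; apply: measurable_digit; exact: mX.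
have [q qE] : exists q : nat -> C -> R, forall n c, pr (mg_P W) (a n @^-1` [set c]) = q n c.
  by exists (fun n c => pr (mg_P W) (a n @^-1` [set c])).
have q1 n c : `|q n c| <= 1 by rewrite -qE pr_norm.
have [z zq] : exists z : C -> R, forall c, (q ^~ c) @ ultra --> z c.
  by exists (fun c => ulim (q ^~ c)) => c; apply: (@cvg_ulim _ _ 1).
have cS : (fun n => \sum_c `|q n c - z c|) @ ultra --> (\sum_(c : C) 0 : R).
  apply: cvg_bigsum => c; rewrite -(normr0 R) -(subrr (z c)).
  by apply: cvg_norm; apply: cvgB; [exact: zq|exact: cvg_cst].
rewrite big1// in cS.
have near4 : ultra [set n | \sum_c `|q n c - z c| <= e / 4].
  by apply: filterS (near_ulimB e4 cS) => n /=; rewrite subr0 ger0_norm ?sumr_ge0.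
(* Both [q n] and [q n0] are within [e / 4] of the limit [z], hence within [e / 2] of each other. *)
have [n0 /= Hn0] := filter_ex near4.
have lf i : exists f, ibounded 1 f /\ {ae mu, forall x, st f x = v n0 i x}.
  have [x|f f1 fv] := @loeb_lift _ _ _ P (v n0 i) 1 (tv n0 i).1.
    by rewrite ler_norml; exact: (tv n0 i).2.
  by exists f.
pose f i := projT1 (cid (lf i)).
have f1 i : ibounded 1 (f i) by have [] := projT2 (cid (lf i)).
have fv i : {ae mu, forall x, st (f i) x = v n0 i x} by have [] := projT2 (cid (lf i)).
have tf n : test_family (fun i => f i n).
  by move=> i; split=> [|y]; [exact: (f1 i).1|rewrite -ler_norml; exact: (f1 i).2].
have near2 := near_profile_dist e2 (tv n0) f1 fv.
have [n [/= [nle Hn] vf]] := filter_ex (filterI (filterI bad near4) near2).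
have qq : \sum_c `|q n c - q n0 c| <= e / 2.
  apply: (@le_trans _ _ (\sum_c (`|q n c - z c| + `|q n0 c - z c|))).
    apply: ler_sum => c _; rewrite (distrC (q n0 c)).
    by rewrite (_ : q n c - q n0 c = (q n c - z c) + (z c - q n0 c)) ?ler_normD//; ring.
  by rewrite big_split/=; lra.
have vv : profile_dist W (v n) W (v n0) <= e / 2.
  apply: (dLP_cells e2 (mX n) (mX n0) (ma n) (ma n0) (X1 n) (X1 n0)) => [x y hx hy ab|].
    apply: le_lt_trans HJ; apply: edist_le => [|j].
      by rewrite mulr_ge0// exprn_ge0// invr_ge0.
    apply: (@cell_close _ _ _ (dsum J (digit^~ (X n0 y j)))).
      rewrite -(dsum_eq (b := digit^~ (X n x j))); first exact: dsum_digit.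
      move=> j'; have := congr1 (fun c : C => c (j, j')) ab; rewrite !ffunE /=.
      by rewrite !asboolb.
    exact: dsum_digit.
  by under eq_bigr do rewrite !qE; exact: qq.
have := bv n nle _ (tf n); rewrite ltNge => /negP; apply.
apply: (@le_trans _ _ (profile_dist W (v n) W (v n0) +
    profile_dist W (v n0) (G n) (fun i => f i n))).
  by apply: dLP_triangle; exact: measurable_profile.
by apply: (le_trans (lerD vv vf)); rewrite -splitr.
Qed.

Lemma near_dM e : 0 < e -> ultra [set n | dM (G n) W < e].
Proof.
move=> e0; have e4 : 0 < e / 4 by rewrite divr_gt0.
have [N HN] := half_expn_small e4.
have : ultra [set n | forall k : 'I_N, dH k.+1 (G n) W <= e / 4].
  apply: filter_forall => k.
  apply: filterS (filterI (near_dH_half_to k.+1 e4) (near_dH_half_from k.+1 e4)) => n.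
  by move=> [/= h1 h2]; rewrite ge_max h1.
apply: filterS => n /= Hk; apply: le_lt_trans (dM_le_series (G n) W N) _.
suff : dM_partial (G n) W N <= e / 4 by lra.
rewrite /dM_partial big_mkord; apply: (@le_trans _ _ (\sum_(k < N) (e / 4) * 2^-1 ^+ k.+1)).
  apply: ler_sum => k _; rewrite /dM_term -exprVn mulrC; apply: ler_wpM2r; last exact: Hk.
  by rewrite exprn_ge0// invr_ge0.
rewrite -mulr_sumr sum_half_expn; apply: ler_piMr; first exact: ltW.
by rewrite gerBl exprn_ge0// invr_ge0.
Qed.

End ultraproduct_limit.

(** * From cluster points to finite subcovers *)

Section compactness.
Context {R : realType}.
Implicit Types G H W : MarkovGraphop R.

Lemma dM_subsequence (G : nat -> MarkovGraphop R) : exists W, forall e N, 0 < e ->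
  exists2 n, (N <= n)%N & dM (G n) W < e.
Proof.
exists (ultraproduct G) => e N e0.
by have [n [/= Nn nW]] := filter_ex (filterI (ultra_ge N) (near_dM G e0)); exists n.
Qed.

(** Otherwise some balls of radius $1/(n+1)$ lie in no member of the cover, yet a member around a
    cluster point of their centres swallows one of them. *)
Lemma lebesgue_number (I : Type) (U : I -> MarkovGraphop R -> Prop) :
  (forall i, dM_open (U i)) -> (forall G, exists i, U i G) ->
  exists2 r : R, 0 < r & forall G, exists i, forall H, dM G H < r -> U i H.
Proof.
move=> oU cU; apply: contrapT => nr.
have bad n : exists G, forall i, ~ forall H, dM G H < n.+1%:R^-1 -> U i H.
  apply: contrapT => nG; apply: nr; exists n.+1%:R^-1; first by rewrite invr_gt0.
  move=> G; apply: contrapT => ni; apply: nG; exists G => i h.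
  by apply: ni; exists i.
pose G n := projT1 (cid (bad n)).
have GP n : forall i, ~ forall H, dM (G n) H < n.+1%:R^-1 -> U i H := projT2 (cid (bad n)).
have [W WP] := dM_subsequence G.
have [i UW] := cU W; have [e e0 He] := oU i W UW.
have e2 : 0 < e / 2 by rewrite divr_gt0.
have [N] := ltr_add_invr e2; rewrite add0r => Ne.
have [n Nn nW] := WP (e / 2) N e2.
apply: (GP n i) => H nH; apply: He.
apply: le_lt_trans (dM_triangle W (G n) H) _; rewrite (dMC W).
have : n.+1%:R^-1 <= N.+1%:R^-1 :> R by rewrite lef_pV2 ?posrE// ler_nat ltnS.
by move: nW nH Ne; set a := n.+1%:R^-1; set b := N.+1%:R^-1; lra.
Qed.

Lemma dM_totally_bounded (r : R) G0 : 0 < r ->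
  exists N (c : nat -> MarkovGraphop R), forall G, exists2 j, (j < N)%N & dM (c j) G < r.
Proof.
move=> r0; apply: contrapT => nb.
have bad N (c : nat -> MarkovGraphop R) : {G | forall j, (j < N)%N -> r <= dM (c j) G}.
  apply: cid; apply: contrapT => ns; apply: nb; exists N, c => G.
  apply: contrapT => nj; apply: ns; exists G => j jN.
  by rewrite leNgt; apply/negP => h; apply: nj; exists j.
pose far N c := projT1 (bad N c).
(* Each new point must be far from all earlier ones, so the recursion carries the whole list, stored
   as a function with default value [G0]. *)
pose c_ := fix F N := if N is N'.+1 then
  (fun m => if m == N' then far N' (F N') else F N' m) else fun=> G0.
pose G n := far n (c_ n).
have c_E n m : (m < n)%N -> c_ n m = G m.
  elim: n => // n IH; rewrite ltnS leq_eqVlt /= => /predU1P[->|mn]; first by rewrite eqxx.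
  by rewrite ltn_eqF// IH.
have [W WP] := dM_subsequence G.
have r2 : 0 < r / 2 by rewrite divr_gt0.
have [m _ mW] := WP _ 0%N r2; have [n mn nW] := WP _ m.+1 r2.
have := projT2 (bad n (c_ n)) m mn.
rewrite c_E// -/(far n (c_ n)) -/(G n) leNgt => /negP; apply.
apply: le_lt_trans (dM_triangle _ W _) _; rewrite (dMC W).
by rewrite [ltRHS]splitr; exact: ltrD.
Qed.

Lemma dM_is_compact : dM_compact R.
Proof.
(* The case split supplies a seed [G0] without constructing a Markov graphop; with none, the empty
   subcover works. *)
move=> I U oU cU; have [[G0 _]|noG] := pselect (exists G : MarkovGraphop R, True); last first.
  have no (j : 'I_0) : False by case: j.
  by exists 0%N, (fun j => False_rect I (no j)) => G; case: noG; exists G.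
have [r r0 rP] := lebesgue_number oU cU.
have [N [c cP]] := dM_totally_bounded G0 r0.
pose f (j : 'I_N) := projT1 (cid (rP (c j))).
exists N, f => G; have [j jN jG] := cP G; exists (Ordinal jN).
exact: (projT2 (cid (rP (c j)))).
Qed.

End compactness.

(** (M, d_M) is a compact metric space: d_M is a pseudometric on Markov graphops
    (hence a metric on weak-equivalence classes) and the induced space is compact. *)
Theorem theorem3p6 (R : realType) :
  [/\ (forall G : MarkovGraphop R, dM G G = 0),
      (forall G H : MarkovGraphop R, 0 <= dM G H),
      (forall G H : MarkovGraphop R, dM G H = dM H G),
      (forall G H K : MarkovGraphop R, dM G K <= dM G H + dM H K)
    & dM_compact R].
Proof.
split; [exact: dMxx|exact: dM_ge0|exact: dMC|move=> G H K; exact: dM_triangle|].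
exact: dM_is_compact.
Qed.
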